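(* Let $M$ and $N$ be two connected complex manifolds of complex dimension $n$, and let $f:M\to N$ be a holomorphic map such that (1) $f$ has at least one regular point; (2) $f(M)$ is closed in $N$. Then $f$ is surjective.
   Context: Manifolds are without boundary, Hausdorff and second countable. A point $p\in M$ is a regular point of $f$ if the differential $df_p:T_pM\to T_{f(p)}N$ is surjective (here, equivalently, an isomorphism). *)

(* Defs.v *)
From HB Require Import structures.
From mathcomp Require Import all_boot all_order all_algebra.
From mathcomp Require Import complex.
From mathcomp Require Import all_classical all_reals all_analysis.

Set Implicit Arguments.
Unset Strict Implicit.
Unset Printing Implicit Defensive.

Import Order.TTheory GRing.Theory Num.Theory numFieldNormedType.Exports.

Local Open Scope classical_set_scope.
Local Open Scope ring_scope.
Local Open Scope complex_scope.

(* The topology and norm of R[i] as a module over itself, i.e. those given by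
   the complex modulus. *)
HB.instance Definition _ (R : realType) := PseudoPointedMetric.copy R[i] R[i]^o.
HB.instance Definition _ (R : realType) := GRing.ComAlgebra.copy R[i] R[i]^o.
HB.instance Definition _ (R : realType) := Vector.copy R[i] R[i]^o.
HB.instance Definition _ (R : realType) := NormedModule.copy R[i] R[i]^o.

(* [differentiable] over the field R[i] is complex (Frechet) differentiability.
   This notion is only used at all points of an open set, where it means
   holomorphy. *)
Definition holomorphic_on (R : realType) (m n : nat) (U : set 'rV[R[i]]_m)
    (g : 'rV[R[i]]_m -> 'rV[R[i]]_n) : Prop :=
  forall z, U z -> differentiable g z.

(* A homeomorphism from an open subset of M onto an open subset of C^n. Both
   [chart_map] and [chart_inv] are total functions whose values are irrelevant
   outside [chart_dom] and its image, respectively. *)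
Record chart (R : realType) (n : nat) (M : topologicalType) := Chart {
  chart_dom : set M;
  chart_map :> M -> 'rV[R[i]]_n;
  chart_inv : 'rV[R[i]]_n -> M;
  chart_dom_open : open chart_dom;
  chart_img_open : open (chart_map @` chart_dom);
  chart_mapK : forall p, chart_dom p -> chart_inv (chart_map p) = p;
  chart_map_continuous : {within chart_dom, continuous chart_map};
  chart_inv_continuous :
    {within chart_map @` chart_dom, continuous chart_inv} }.

Record complexManifold (R : realType) (n : nat) := ComplexManifold {
  manifold_space :> topologicalType;
  manifold_hausdorff : hausdorff_space manifold_space;
  manifold_second_countable : @second_countable manifold_space;
  atlas : set (chart R n manifold_space);
  atlas_cover : forall p, exists c, atlas c /\ chart_dom c p;
  atlas_compatible : forall c d, atlas c -> atlas d ->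
    holomorphic_on (c @` (chart_dom c `&` chart_dom d)) (d \o chart_inv c) }.

Definition holomorphic (R : realType) (m n : nat) (M : complexManifold R m)
    (N : complexManifold R n) (f : M -> N) : Prop :=
  continuous f /\
  forall c d, atlas c -> atlas d ->
    holomorphic_on (c @` (chart_dom c `&` f @^-1` chart_dom d))
      (d \o f \o chart_inv c).

Definition chart_at (R : realType) (n : nat) (M : complexManifold R n) (p : M) :=
  {c : chart R n M | atlas c /\ chart_dom c p}.

Definition chart_at_chart (R : realType) (n : nat) (M : complexManifold R n)
  (p : M) (c : chart_at p) : chart R n M := sval c.
Coercion chart_at_chart : chart_at >-> chart.

(* The holomorphic tangent space T_p M (of complex dimension n): a tangent
   vector is a family of coordinate vectors in C^n, one for each chart at p,
   related by the differentials of the transition maps. *)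
Record tangent (R : realType) (n : nat) (M : complexManifold R n) (p : M) :=
  Tangent {
    tangent_coord : chart_at p -> 'rV[R[i]]_n;
    tangent_compatible : forall c d : chart_at p,
      tangent_coord d = 'd (d \o chart_inv c) (c p) (tangent_coord c) }.

Lemma near_eq_differential (K : numFieldType) (V W : normedModType K)
    (f g : V -> W) (x : V) :
  (\forall y \near x, f y = g y) -> differentiable f x ->
  differentiable g x /\ 'd g x = 'd f x :> (V -> W).
Proof.
move=> fg df.
have fgx : f x = g x := nbhs_singleton fg.
have key : g \o shift x = cst (g x) + 'd f x +o_ 0 id.
  apply/eqaddoP => e e0.
  have /eqaddoP/(_ e e0) := diff_locally df.
  move: fg; rewrite (near_shift 0 x) subr0 => fg.
  move=> H; near=> h.
  have -> : (g \o shift x - (cst (g x) + 'd f x)) h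
          = (f \o shift x - (cst (f x) + 'd f x)) h.
    rewrite -fgx !fctE /=; congr (_ - _).
    by apply/esym; near: h.
  by near: h.
have dg : 'd g x = 'd f x :> (V -> W).
  by apply: diff_unique key; exact: diff_continuous.
split=> //; apply/diff_locallyP; rewrite dg; split=> //.
exact: diff_continuous.
Unshelve. all: by end_near. Qed.

Lemma near_eq_diff_comp (K : numFieldType) (U V W : normedModType K)
    (g : U -> V) (h : V -> W) (f : U -> W) (x : U) (y : V) :
  g x = y -> differentiable g x -> differentiable h y ->
  (\forall z \near x, h (g z) = f z) ->
  forall v, 'd f x v = 'd h y ('d g x v).
Proof.
move=> <- dg dh hgf v.
have [_ ->] := near_eq_differential hgf (differentiable_comp dg dh).
by rewrite diff_comp.
Qed.

Section charts.
Context (R : realType) (n : nat) (M : topologicalType).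
Implicit Types (c : chart R n M) (p : M).

Lemma chart_inv_cvg c p : chart_dom c p -> chart_inv c @ c p --> p.
Proof.
move=> cp; have := @chart_inv_continuous _ _ _ c.
rewrite continuous_open_subspace; last exact: chart_img_open.
have cpi : c p \in c @` chart_dom c by rewrite inE; exists p.
by move=> /(_ _ cpi); rewrite /continuous_at (chart_mapK cp).
Qed.

Lemma near_chart_invK c p : chart_dom c p ->
  \forall z \near c p, c (chart_inv c z) = z.
Proof.
move=> cp; have : nbhs (c p) (c @` chart_dom c).
  by apply: open_nbhs_nbhs; split; [exact: chart_img_open|exists p].
by apply: filterS => _ [q cq <-]; rewrite (chart_mapK cq).
Qed.

Lemma near_chart_dom c p : chart_dom c p -> \forall q \near p, chart_dom c q.
Proof. by move=> cp; apply: open_nbhs_nbhs; split=> //; exact: chart_dom_open. Qed.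

End charts.

Section charts_at_point.
Context (R : realType) (m n : nat).
Context (M : complexManifold R m) (N : complexManifold R n).
Variables (f : M -> N) (hf : holomorphic f) (p : M).

Lemma chart_atP (c : chart_at p) : chart_dom c p.
Proof. by case: c => c []. Qed.

Lemma holomorphic_differentiable (c : chart_at p) (d : chart_at (f p)) :
  differentiable (d \o f \o chart_inv c) (c p).
Proof.
case: c d => [c [ac cp]] [d [ad dfp]] /=.
by apply: (hf.2 c d ac ad); exists p.
Qed.

Lemma transition_differentiable (c d : chart_at p) :
  differentiable (d \o chart_inv c) (c p).
Proof.
case: c d => [c [ac cp]] [d [ad dp]] /=.
by apply: (@atlas_compatible _ _ M c d ac ad); exists p.
Qed.

End charts_at_point.

Section differential.
Context (R : realType) (m n : nat).
Context (M : complexManifold R m) (N : complexManifold R n).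
Variables (f : M -> N) (hf : holomorphic f) (p : M).

Lemma differential_target (c : chart_at p) (d d' : chart_at (f p)) v :
  'd (d' \o f \o chart_inv c) (c p) v =
  'd (d' \o chart_inv d) (d (f p)) ('d (d \o f \o chart_inv c) (c p) v).
Proof.
apply: near_eq_diff_comp.
- by rewrite /= (chart_mapK (chart_atP c)).
- exact: holomorphic_differentiable.
- exact: transition_differentiable.
- have fc : (f \o chart_inv c) @ c p --> f p.
    by apply: cvg_comp (chart_inv_cvg (chart_atP c)) _; exact: hf.1.
  have : \forall z \near c p, chart_dom d (f (chart_inv c z)).
    exact: fc _ (near_chart_dom (chart_atP d)).
  by apply: filterS => z /= dz; rewrite (chart_mapK dz).
Qed.

Lemma differential_source (c c' : chart_at p) (d : chart_at (f p)) v :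
  'd (d \o f \o chart_inv c) (c p) v =
  'd (d \o f \o chart_inv c') (c' p) ('d (c' \o chart_inv c) (c p) v).
Proof.
apply: near_eq_diff_comp.
- by rewrite /= (chart_mapK (chart_atP c)).
- exact: transition_differentiable.
- exact: holomorphic_differentiable.
- have : \forall z \near c p, chart_dom c' (chart_inv c z).
    exact: (chart_inv_cvg (chart_atP c)) _ (near_chart_dom (chart_atP c')).
  by apply: filterS => z /= cz; rewrite (chart_mapK cz).
Qed.

Definition some_chart_at : chart_at p := cid (atlas_cover p).

Lemma differential_compatible (v : tangent p) (d d' : chart_at (f p)) :
  let c := some_chart_at in
  'd (d' \o f \o chart_inv c) (c p) (tangent_coord v c) =
  'd (d' \o chart_inv d) (d (f p))
    ('d (d \o f \o chart_inv c) (c p) (tangent_coord v c)).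
Proof. exact: differential_target. Qed.

(* df_p : T_p M -> T_{f(p)} N; it does not depend on the chart used at p, see
   [differentialE]. *)
Definition differential (v : tangent p) : tangent (f p) :=
  Tangent (differential_compatible v).

Lemma differentialE (v : tangent p) (c : chart_at p) (d : chart_at (f p)) :
  tangent_coord (differential v) d =
  'd (d \o f \o chart_inv c) (c p) (tangent_coord v c).
Proof.
apply: etrans (differential_source _ c _ _) _.
exact: congr1 (esym (tangent_compatible v _ _)).
Qed.

Definition regular_point : Prop :=
  set_surj [set: tangent p] [set: tangent (f p)] differential.

End differential.

Section tangent_theory.
Context (R : realType) (n : nat) (M : complexManifold R n) (p : M).

Lemma holomorphic_id : holomorphic (@id M).
Proof.
split; first by move=> x; exact: cvg_id.
by move=> c d ac ad; exact: atlas_compatible.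
Qed.

Lemma tangent_eq (v w : tangent p) : tangent_coord v = tangent_coord w -> v = w.
Proof.
by case: v w => [v hv] [w hw] /= e; subst w; congr Tangent; exact: Prop_irrelevance.
Qed.

Lemma tangent_coord_bij (c : chart_at p) :
  bijective (fun v : tangent p => tangent_coord v c).
Proof.
have compat (u : 'rV[R[i]]_n) (d d' : chart_at p) :
    'd (d' \o chart_inv c) (c p) u =
    'd (d' \o chart_inv d) (d p) ('d (d \o chart_inv c) (c p) u).
  exact: (differential_target holomorphic_id c d d').
exists (fun u => Tangent (compat u)) => [v|u].
  by apply: tangent_eq; apply/funext => d /=; rewrite -tangent_compatible.
have idd : is_diff (c p) (@id 'rV[R[i]]_n) id by exact: is_diff_id.
have cK : \forall z \near c p, id z = (c \o chart_inv c) z.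
  by apply: filterS (near_chart_invK (chart_atP c)) => z /= ->.
rewrite /=; have [_ ->] := near_eq_differential cK (@ex_diff _ _ _ _ _ _ _ idd).
by rewrite diff_val.
Qed.

End tangent_theory.

(* Main.v *)
Require Import Defs.
From mathcomp Require Import all_boot all_order all_algebra.
From mathcomp Require Import complex.
From mathcomp Require Import all_classical all_reals all_analysis.
From mathcomp Require Import ring lra.

(** Let Crit be the set of critical points of f.  If f(M) is not all of N, then,
N being connected and f(M) closed with an interior point (the image of a regular
point), some y lies on the boundary of the interior of f(M).  In a ball of a
chart d around y pick a in the interior of f(M) and b outside f(M).  The idea is
that d(f(Crit)) is too thin to separate a from b: it is a countable union of
sets of real dimension at most 2n-2, so the union of the rays from a through
it has empty interior, and some b' near b, still outside f(M), can be joined to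
a by a segment missing f(Crit), except perhaps at a ([small_set_avoided]).  Along that segment
belonging to f(M) is an open condition, because a point of f(M) which is not a
critical value is interior to f(M) ([regular_interior]), and a closed one,
because f(M) is closed; hence b' is in f(M), a contradiction.

The thinness of f(Crit) ([critical_image_small]) comes from a stratification of
Crit.  In charts Crit is the zero set of the Jacobian determinant h, a
holomorphic function.  Since M is connected and f has a regular point, the
identity principle ([hol_flat]) shows that at no point do all the partial
derivatives of h vanish ([local_det_not_flat]).  So Crit is covered by the
countably many sets where some iterated derivative g of h vanishes but some first
derivative of g does not, and such a set is locally a Lipschitz graph over the
n-1 remaining complex coordinates ([level_set_graph]); second countability of
M makes the cover by local pieces countable.

Thinness is measured by real coordinates with a Lipschitz inverse
([coordinatized]), which passes to Lipschitz images and costs one more coordinate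
for rays ([coordinatized_cone]).  A subset of C^n with fewer than 2n coordinates is
nowhere dense by counting grid points ([coordinatized_nowhere_dense]), and
Baire's argument handles countable unions.

Holomorphy means here complex differentiability at each point, so that the
regularity of holomorphic functions has to be established.  Goursat's bisection
applied to q(exp(s + it)) on a rectangle of height 2 pi gives at once that the mean
of q on the circle of radius r does not depend on r ([cmean_annulus]).  Letting
r tend to 0 yields the mean value property and the formula expressing q'(0) as the
mean of q(z)/z ([cmean_derivative]).  These two facts at the centre of a circle
suffice for everything: partial derivatives are Lipschitz and again
holomorphic ([hol_pd]), and functions are strictly differentiable
([hol_strict]), whence the openness of f at regular points ([holmap_open]). *)

Set Implicit Arguments.
Unset Strict Implicit.
Unset Printing Implicit Defensive.
Import Order.TTheory GRing.Theory Num.Theory numFieldNormedType.Exports.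
Local Open Scope classical_set_scope.
Local Open Scope ring_scope.
Local Open Scope complex_scope.

(** * Real-valued norms and completeness of C^n *)

Section realnorm.
Context {R : realType} {V : normedZmodType R[i]}.
Implicit Types (u v w : V).

(** The norms of R[i] and of R[i]^n take their values in R[i], which is not totally
ordered; [nm] is the same norm with values in R. *)
Definition nm v : R := complex.Re `|v|.

Lemma normE v : `|v| = (nm v)%:C.
Proof. by rewrite /nm RRe_real // normr_real. Qed.

Lemma nm_ge0 v : 0 <= nm v.
Proof. by rewrite -lecR -normE normr_ge0. Qed.

Lemma nmD u v : nm (u + v) <= nm u + nm v.
Proof. by rewrite -lecR rmorphD /= -!normE ler_normD. Qed.

Lemma nmN v : nm (- v) = nm v. Proof. by rewrite /nm normrN. Qed.
Lemma nm0 : nm (0 : V) = 0. Proof. by rewrite /nm normr0. Qed.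
Lemma nm0_eq0 v : nm v = 0 -> v = 0.
Proof. by move=> h; apply/normr0_eq0; rewrite normE h. Qed.
Lemma nm_gt0 v : v != 0 -> 0 < nm v.
Proof. by rewrite -normr_gt0 normE ltcR. Qed.

Lemma nmC u v : nm (u - v) = nm (v - u).
Proof. by rewrite -nmN opprB. Qed.
Lemma nmB u v : nm (u - v) <= nm u + nm v.
Proof. by rewrite (le_trans (nmD _ _)) // nmN. Qed.
Lemma nm_tri w u v : nm (u - v) <= nm (u - w) + nm (w - v).
Proof. by rewrite -lecR rmorphD /= -!normE ler_distD. Qed.

Lemma nm_sum (I : Type) (r : seq I) (P : pred I) (F : I -> V) :
  nm (\sum_(i <- r | P i) F i) <= \sum_(i <- r | P i) nm (F i).
Proof.
elim/big_ind2: _ => [|a b c d ab cd|//]; first by rewrite nm0.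
exact: le_trans (nmD _ _) (lerD ab cd).
Qed.

End realnorm.

Section complexnorm.
Context {R : realType}.
Local Notation C := R[i].
Implicit Types z w : C.

Lemma nmM z w : nm (z * w) = nm z * nm w.
Proof. by apply: complexI; rewrite rmorphM /= -!normE normrM. Qed.
Lemma nm1 : nm (1 : C) = 1.
Proof. by apply: complexI; rewrite -normE normr1. Qed.
Lemma nmX z k : nm (z ^+ k) = nm z ^+ k.
Proof. by apply: complexI; rewrite rmorphXn /= -!normE normrX. Qed.
Lemma nmV z : nm z^-1 = (nm z)^-1.
Proof. by apply: complexI; rewrite fmorphV /= -!normE normfV. Qed.
Lemma nmR (x : R) : nm x%:C = `|x|.
Proof. by rewrite /nm normc_def /= expr0n /= addr0 sqrtr_sqr. Qed.
Lemma nmi : nm ('i : C) = 1.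
Proof. by rewrite /nm normc_def /= expr0n expr1n /= add0r sqrtr1. Qed.

Lemma nmE z : nm z = Num.sqrt (complex.Re z ^+ 2 + complex.Im z ^+ 2).
Proof. by rewrite /nm normc_def. Qed.
Lemma nm_Re z : `|complex.Re z| <= nm z.
Proof. by rewrite nmE -sqrtr_sqr ler_wsqrtr // lerDl sqr_ge0. Qed.
Lemma nm_Im z : `|complex.Im z| <= nm z.
Proof. by rewrite nmE -sqrtr_sqr ler_wsqrtr // lerDr sqr_ge0. Qed.
Lemma nm_ReIm z : nm z <= `|complex.Re z| + `|complex.Im z|.
Proof.
rewrite [in nm z](complexE z) (le_trans (nmD _ _)) // nmM nmi !nmR mul1r //.
Qed.

Lemma nmZ (V : normedModType C) z (v : V) : nm (z *: v) = nm z * nm v.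
Proof. by apply: complexI; rewrite rmorphM /= -!normE normrZ. Qed.

Lemma nm_rV n (v : 'rV[C]_n) i : nm (v 0 i) <= nm v.
Proof.
rewrite -lecR -!normE [leRHS]/Num.norm /= mx_normE -[leLHS]nngE num_le.
exact: (le_bigmax _ (fun ij : 'I_1 * 'I_n => `|v ij.1 ij.2|%:nng) (0, i)).
Qed.

Lemma nm_rV_attained n (v : 'rV[C]_n) : v != 0 -> exists i, nm v = nm (v 0 i).
Proof.
move=> v0; have /mx_norm_neq0 [[a i] /= h] : mx_norm v != 0.
  by apply: contraNN v0 => /eqP/mx_norm_eq0/eqP.
by exists i; apply: complexI; rewrite -!normE [LHS]/Num.norm /= h ord1.
Qed.

Lemma nm_rV_le n (v : 'rV[C]_n) (e : R) : 0 <= e -> (forall i, nm (v 0 i) <= e) ->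
  nm v <= e.
Proof.
have [->|/nm_rV_attained[i ->] //] := eqVneq v 0.
by rewrite nm0.
Qed.
Lemma nbhs_nmP (V : normedModType C) (z : V) (A : set V) :
  nbhs z A <-> exists2 e : R, 0 < e & forall y, nm (y - z) < e -> A y.
Proof.
split.
  move=> /nbhs_normP[e /= e0 h]; exists (complex.Re e).
    by move: e0; rewrite ltcE => /andP[].
  move=> y yz; apply: h => /=.
  move: e0; rewrite ltcE => /andP[/eqP ime _].
  have -> : e = (complex.Re e)%:C by case: e ime {yz} => a b /= ->.
  by rewrite normE ltcR nmC.
case=> e e0 h; apply/nbhs_normP; exists e%:C => /=; first by rewrite ltcR.
by move=> y /=; rewrite normE ltcR nmC => /h.
Qed.
End complexnorm.

Section completeness.
Context {R : realType}.
Local Notation C := R[i].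

(** The sequences a_k - 2 c 2^-k and a_k + 2 c 2^-k are monotone and enclose the
limit. *)
Lemma geom_cvg_real (a : nat -> R) (c : R) :
  (forall k, `|a k.+1 - a k| <= c * 2^-1 ^+ k) ->
  exists l, forall k, `|a k - l| <= 2 * c * 2^-1 ^+ k.
Proof.
move=> ha.
have c0 : 0 <= c by have := le_trans (normr_ge0 _) (ha 0); rewrite expr0 mulr1.
pose h k : R := 2 * c * 2^-1 ^+ k.
have hS k : h k.+1 = h k / 2 by rewrite /h exprS; lra.
have h0 k : 0 <= h k by rewrite /h !mulr_ge0 // exprn_ge0 // invr_ge0.
have ha' k : `|a k.+1 - a k| <= h k / 2.
  by have := ha k; rewrite /h; set t := _ ^+ _; set u := _ - _; lra.
have step k : a k - h k <= a k.+1 - h k.+1 /\ a k.+1 + h k.+1 <= a k + h k.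
  by rewrite hS; move: (ha' k) (h0 k); rewrite ler_distl => /andP[]; lra.
have mono d k : a k - h k <= a (k + d)%N - h (k + d)%N /\
    a (k + d)%N + h (k + d)%N <= a k + h k.
  elim: d => [|d [i1 i2]]; first by rewrite addn0.
  by rewrite addnS; have [] := step (k + d)%N; lra.
have bu j k : a j - h j <= a k + h k.
  have [lo _] := mono k j; have [_ hi] := mono j k; rewrite addnC in hi.
  by have := h0 (j + k)%N; rewrite addnC in lo hi *; lra.
pose B := range (fun j => a j - h j).
have supB : has_sup B.
  by split; [exists (a 0%N - h 0%N), 0%N | exists (a 0%N + h 0%N) => _ [j _ <-]].
exists (sup B) => k; rewrite -/(h k) ler_distl.
have lo : a k - h k <= sup B by apply: ub_le_sup; [case: supB|exists k].
have hi : sup B <= a k + h k by apply: ge_sup; [case: supB|move=> _ [j _ <-]].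
by apply/andP; split; lra.
Qed.

Lemma geom_cvg n (a : nat -> 'rV[C]_n) (c : R) :
  (forall k, nm (a k.+1 - a k) <= c * 2^-1 ^+ k) ->
  exists l, forall k, nm (a k - l) <= 4 * c * 2^-1 ^+ k.
Proof.
move=> ha.
have c0 : 0 <= c by have := le_trans (nm_ge0 _) (ha 0); rewrite expr0 mulr1.
have /choice[x hx] : forall i : 'I_n, exists l, forall k,
    `|complex.Re (a k 0 i) - l| <= 2 * c * 2^-1 ^+ k.
  move=> i; apply: geom_cvg_real => k; apply: le_trans (ha k).
  apply: le_trans (nm_rV _ i); rewrite !mxE.
  by apply: le_trans (nm_Re _); case: (a k.+1 0 i) (a k 0 i) => [? ?] [? ?].
have /choice[y hy] : forall i : 'I_n, exists l, forall k,
    `|complex.Im (a k 0 i) - l| <= 2 * c * 2^-1 ^+ k.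
  move=> i; apply: geom_cvg_real => k; apply: le_trans (ha k).
  apply: le_trans (nm_rV _ i); rewrite !mxE.
  by apply: le_trans (nm_Im _); case: (a k.+1 0 i) (a k 0 i) => [? ?] [? ?].
exists (\row_i (x i +i* y i)) => k; apply: nm_rV_le => [|i].
  by rewrite !mulr_ge0 // exprn_ge0 // invr_ge0.
rewrite !mxE (le_trans (nm_ReIm _)) //.
have := hx i k; have := hy i k; case: (a k 0 i) => [u v] /=.
by set t := _ ^+ k; move=> *; lra.
Qed.

Lemma half_pow_lt (c e : R) : 0 < e -> exists k, c * 2^-1 ^+ k < e.
Proof.
move=> e0; have [c0|c0] := leP c 0.
  by exists 0%N; rewrite expr0 mulr1; lra.
pose k := (Num.truncn (c / e)).+1; exists k.
have k1 : c / e < k%:R by exact: truncnS_gt.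
have k2 : k%:R < 2 ^+ k :> R by rewrite -natrX ltr_nat ltn_expl.
rewrite exprVn -ltr_pdivlMr ?invr_gt0 ?exprn_gt0 // invrK.
by rewrite mulrC -ltr_pdivrMr //; lra.
Qed.

End completeness.

(** * Bisection *)

Section bisection.
Context {R : realType}.

Lemma halving_limit (u : nat -> R) (a : R) : 0 <= a ->
  (forall k, u k.+1 = u k \/ u k.+1 = u k + a * 2^-1 ^+ k.+1) ->
  exists x, forall k, u k <= x <= u k + a * 2^-1 ^+ k.
Proof.
move=> a0 hu.
have h0 k : 0 <= a * 2^-1 ^+ k by rewrite mulr_ge0 // exprn_ge0 // invr_ge0.
have hS k : a * 2^-1 ^+ k.+1 = a * 2^-1 ^+ k / 2 by rewrite exprS; lra.
have [x hx] : exists l, forall k, `|u k - l| <= 2 * (a / 2) * 2^-1 ^+ k.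
  apply: geom_cvg_real => k.
  have -> : a / 2 * 2^-1 ^+ k = a * 2^-1 ^+ k.+1 by rewrite hS; lra.
  by rewrite ler_norml; have := h0 k.+1; case: (hu k) => ->; lra.
exists x => k; have step j d : u j <= u (j + d)%N.
  elim: d => [|d IH]; first by rewrite addn0.
  by rewrite addnS; have := h0 (j + d).+1; case: (hu (j + d)%N) => ->; lra.
have := hx k; rewrite ler_norml => /andP[lo hi]; apply/andP; split; last first.
  by move: lo; set t := _ ^+ _; lra.
rewrite leNgt; apply/negP => xu.
have [m hm] := @half_pow_lt R a (u k - x) ltac:(lra).
have := step k m; have := hx (k + m)%N; rewrite ler_norml => /andP[_].
rewrite mulrCA mulfV // mulr1.
have : a * 2^-1 ^+ (k + m) <= a * 2^-1 ^+ m.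
  rewrite ler_wpM2l // ler_wiXn2l ?invr_ge0 ?leq_addl //.
  by rewrite invf_le1 // ler1n.
lra.
Qed.

(** Bisection in both directions: if P failed on the whole rectangle, it would fail on
one of its quarters, and so on; the nested rectangles shrink to a point at which P
is known to hold locally. *)
Lemma bisection2 (P : R -> R -> R -> R -> Prop) (s a t b : R) :
  0 <= a -> 0 <= b ->
  (forall s a t b, 0 <= a -> 0 <= b ->
    P s (a / 2) t (b / 2) -> P (s + a / 2) (a / 2) t (b / 2) ->
    P s (a / 2) (t + b / 2) (b / 2) -> P (s + a / 2) (a / 2) (t + b / 2) (b / 2) ->
    P s a t b) ->
  (forall x y, s <= x <= s + a -> t <= y <= t + b ->
     exists2 d : R, 0 < d & forall k s' t', 2^-1 ^+ k < d ->
       s' <= x <= s' + a * 2^-1 ^+ k -> t' <= y <= t' + b * 2^-1 ^+ k ->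
       s <= s' -> s' + a * 2^-1 ^+ k <= s + a ->
       t <= t' -> t' + b * 2^-1 ^+ k <= t + b ->
       P s' (a * 2^-1 ^+ k) t' (b * 2^-1 ^+ k)) ->
  P s a t b.
Proof.
move=> a0 b0 glue loc; apply: contrapT => nP.
pose bad k (c : R * R) := ~ P c.1 (a * 2^-1 ^+ k) c.2 (b * 2^-1 ^+ k).
have hS (z : R) k : z * 2^-1 ^+ k.+1 = z * 2^-1 ^+ k / 2 by rewrite exprS; lra.
have h0 (z : R) k : 0 <= z -> 0 <= z * 2^-1 ^+ k.
  by move=> z0; rewrite mulr_ge0 // exprn_ge0 // invr_ge0.
have /choice[nxt hnxt] : forall kc : nat * (R * R), exists c : R * R,
    bad kc.1 kc.2 -> [/\ bad kc.1.+1 c,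
     c.1 = kc.2.1 \/ c.1 = kc.2.1 + a * 2^-1 ^+ kc.1.+1 &
     c.2 = kc.2.2 \/ c.2 = kc.2.2 + b * 2^-1 ^+ kc.1.+1].
  move=> [k [x y]] /=.
  pose x' := x + a * 2^-1 ^+ k.+1; pose y' := y + b * 2^-1 ^+ k.+1.
  apply: contrapT => /forallNP H; have bxy : bad k (x, y).
    by apply: contrapT => h; apply: (H (0, 0)) => /h.
  apply: bxy => /=; apply: glue; rewrite ?h0 // -!hS.
  - by apply: contrapT => h; apply: (H (x, y)) => _; split => //; left.
  - by apply: contrapT => h; apply: (H (x', y)) => _; split => //; [right|left].
  - by apply: contrapT => h; apply: (H (x, y')) => _; split => //; [left|right].
  - by apply: contrapT => h; apply: (H (x', y')) => _; split => //; right.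
pose c := fix c k := if k is k'.+1 then nxt (k', c k') else (s, t).
have cbad k : bad k (c k).
  elim: k => [|k IH] /=; first by rewrite /bad expr0 !mulr1.
  by have [] := hnxt (k, c k) IH.
have c1 k : (c k.+1).1 = (c k).1 \/ (c k.+1).1 = (c k).1 + a * 2^-1 ^+ k.+1.
  by have [] := hnxt (k, c k) (cbad k).
have c2 k : (c k.+1).2 = (c k).2 \/ (c k.+1).2 = (c k).2 + b * 2^-1 ^+ k.+1.
  by have [] := hnxt (k, c k) (cbad k).
have [x hx] := halving_limit a0 c1; have [y hy] := halving_limit b0 c2.
have in1 k : s <= (c k).1 /\ (c k).1 + a * 2^-1 ^+ k <= s + a.
  elim: k => [|k [i1 i2]]; first by rewrite expr0 mulr1 /=.
  by have := h0 a k a0; case: (c1 k) => ->; rewrite hS; lra.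
have in2 k : t <= (c k).2 /\ (c k).2 + b * 2^-1 ^+ k <= t + b.
  elim: k => [|k [i1 i2]]; first by rewrite expr0 mulr1 /=.
  by have := h0 b k b0; case: (c2 k) => ->; rewrite hS; lra.
have [||d d0 hd] := loc x y.
- by have := hx 0%N; rewrite expr0 mulr1.
- by have := hy 0%N; rewrite expr0 mulr1.
have [k] := @half_pow_lt R 1 d d0; rewrite mul1r => kd.
by have [? ?] := in1 k; have [? ?] := in2 k; apply: (cbad k); apply: hd.
Qed.

Lemma bisection1 (P : R -> R -> Prop) (s a : R) : 0 <= a ->
  (forall s a, 0 <= a -> P s (a / 2) -> P (s + a / 2) (a / 2) -> P s a) ->
  (forall x, s <= x <= s + a -> exists2 d : R, 0 < d & forall s' a',
     0 <= a' < d -> s' <= x <= s' + a' -> s <= s' -> s' + a' <= s + a -> P s' a') ->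
  P s a.
Proof.
move=> a0 glue loc.
apply: (@bisection2 (fun s a _ _ => P s a) s a 0 0) => //.
  by move=> s1 a1 _ _ a10 _ ? ? _ _; exact: glue.
move=> x y /loc[d d0 hd] _; exists (d / (a + 1)); first by rewrite divr_gt0 //; lra.
move=> k s' _ kd hs' _ ss' se _ _; apply: hd => //.
have p0 : 0 <= 2^-1 ^+ k :> R by rewrite exprn_ge0 // invr_ge0.
rewrite mulr_ge0 //=; move: kd; rewrite ltr_pdivlMr; last by lra.
by apply: le_lt_trans; rewrite mulrC ler_wpM2l //; lra.
Qed.

Lemma unit_segment_const (Q : R -> Prop) :
  (forall t, 0 <= t <= 1 -> exists2 d : R, 0 < d &
     forall u, `|u - t| < d -> (Q u <-> Q t)) -> Q 0 -> Q 1.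
Proof.
move=> loc; suff : Q 0 -> Q (0 + 1) by rewrite add0r.
apply: (@bisection1 (fun s a => Q s -> Q (s + a))) => //.
  by move=> s a _ h1 h2 /h1/h2; rewrite -addrA -splitr.
move=> t; rewrite add0r => /loc[d d0 hd]; exists d => // s a /andP[a0 ad] /andP[st ta] _ _.
have /hd [sQ _] : `|s - t| < d by rewrite distrC ger0_norm; lra.
have /hd [_ Qsa] : `|s + a - t| < d by rewrite ger0_norm; lra.
by move=> /sQ/Qsa.
Qed.

End bisection.

(** * First-order expansions *)

Section differentials.
Context {R : realType}.
Local Notation C := R[i].

(** First-order expansion g(z + h) = g(z) + L(h) + o(nu h).  The size nu on the source is a
parameter so that functions of a real, of a complex, of several complex and of two
real variables are treated alike. *)
Definition diffat (D : zmodType) (nu : D -> R) (g : D -> C) (z : D) (L : D -> C) :=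
  forall e : R, 0 < e -> exists2 d : R, 0 < d &
    forall h, nu h < d -> nm (g (z + h) - g z - L h) <= e * nu h.

Lemma diffat_ext (D : zmodType) (nu : D -> R) (f g : D -> C) z (L L' : D -> C) (r : R) :
  0 < r -> nu 0 < r -> (forall h, nu h < r -> f (z + h) = g (z + h)) -> L =1 L' ->
  diffat nu f z L -> diffat nu g z L'.
Proof.
move=> r0 n0 fg LL df e e0; have [d d0 hd] := df e e0.
exists (Num.min d r) => [|h]; first by rewrite lt_min d0.
rewrite lt_min => /andP[h1 h2]; rewrite -LL -fg // -[z in g z]addr0 -fg // addr0.
exact: hd.
Qed.

Lemma diffat_lin (D : zmodType) (nu : D -> R) (a b : C) (f g : D -> C) z (L L' : D -> C) :
  (forall h, 0 <= nu h) ->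
  diffat nu f z L -> diffat nu g z L' ->
  diffat nu (fun x => a * f x + b * g x) z (fun h => a * L h + b * L' h).
Proof.
move=> nu0 df dg e e0.
have [a0 b0] := (nm_ge0 a, nm_ge0 b).
have e'0 : 0 < e / (nm a + nm b + 1) by rewrite divr_gt0 //; lra.
have [d d0 hd] := df _ e'0; have [d' d'0 hd'] := dg _ e'0.
exists (Num.min d d') => [|h]; first by rewrite lt_min d0.
rewrite lt_min => /andP[/hd h1 /hd' h2].
have -> : a * f (z + h) + b * g (z + h) - (a * f z + b * g z) - (a * L h + b * L' h)
  = a * (f (z + h) - f z - L h) + b * (g (z + h) - g z - L' h) by ring.
rewrite (le_trans (nmD _ _)) // !nmM.
have := ler_wpM2l a0 h1; have := ler_wpM2l b0 h2; rewrite !mulrA.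
set e' := e / _ in h1 h2 e'0 *; move=> i1 i2.
have : (nm a + nm b) * e' * nu h <= e * nu h.
  rewrite ler_wpM2r // /e' mulrA ler_pdivrMr; last by lra.
  by rewrite mulrC ler_wpM2l //; lra.
by rewrite !mulrDl; move: i1 i2; rewrite !mulrA; lra.
Qed.

Lemma diffat_mul (D : zmodType) (nu : D -> R) (f g : D -> C) z (L L' : D -> C) (K : R) :
  (forall h, 0 <= nu h) ->
  (forall h, nm (L h) <= K * nu h) -> (forall h, nm (L' h) <= K * nu h) ->
  diffat nu f z L -> diffat nu g z L' ->
  diffat nu (fun x => f x * g x) z (fun h => L h * g z + f z * L' h).
Proof.
move=> nu0 hL hL' df dg.
wlog K0 : K hL hL' / 0 <= K.
  move=> W; apply: (W `|K|) => // h.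
    by rewrite (le_trans (hL h)) // ler_wpM2r // ler_norm.
  by rewrite (le_trans (hL' h)) // ler_wpM2r // ler_norm.
move=> e e0.
have [a0 b0] := (nm_ge0 (f z), nm_ge0 (g z)).
pose B := nm (f z) + nm (g z) + 1.
have B0 : 0 < B by rewrite /B; lra.
have e'0 : 0 < Num.min (e / B / 2) 1 by rewrite lt_min ltr01 !divr_gt0.
set e' := Num.min _ _ in e'0.
have e'1 : e' <= 1 by rewrite ge_min lexx orbT.
have e'e : e' <= e / B / 2 by rewrite ge_min lexx.
have [d d0 hd] := df _ e'0; have [d' d'0 hd'] := dg _ e'0.
pose r := e / 2 / (K + 1) ^+ 2.
have K1 : 0 < (K + 1) ^+ 2 by rewrite exprn_gt0 //; lra.
have r0 : 0 < r by rewrite /r !divr_gt0.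
exists (Num.min r (Num.min d d')) => [|h]; first by rewrite !lt_min d0 r0.
rewrite !lt_min => /and3P[hr h1 h2]; have {}h1 := hd _ h1; have {}h2 := hd' _ h2.
set u := f (z + h) - f z in h1; set v := g (z + h) - g z in h2.
have -> : f (z + h) * g (z + h) - f z * g z - (L h * g z + f z * L' h)
  = (u - L h) * g z + f z * (v - L' h) + u * v by rewrite /u /v; ring.
have n0 := nu0 h.
have bnd (w l : C) : nm (w - l) <= e' * nu h -> nm l <= K * nu h -> nm w <= (K + 1) * nu h.
  move=> i1 i2; have := nmD (w - l) l; rewrite subrK => /le_trans; apply.
  rewrite mulrDl mul1r; have : e' * nu h <= 1 * nu h by rewrite ler_wpM2r.
  by lra.
have nu1 := bnd _ _ h1 (hL h); have nv1 := bnd _ _ h2 (hL' h).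
have T3 : nm (u * v) <= e / 2 * nu h.
  rewrite nmM (le_trans (ler_pM (nm_ge0 _) (nm_ge0 _) nu1 nv1)) //.
  rewrite mulrACA -expr2 mulrA ler_wpM2r //.
  by rewrite mulrC -ler_pdivlMr // ltW.
have T1 : nm ((u - L h) * g z + f z * (v - L' h)) <= e / 2 * nu h.
  rewrite (le_trans (nmD _ _)) // !nmM.
  have i1 : nm (u - L h) * nm (g z) <= e' * nu h * nm (g z) by rewrite ler_wpM2r.
  have i2 : nm (f z) * nm (v - L' h) <= nm (f z) * (e' * nu h) by rewrite ler_wpM2l.
  have i3 : e' * B <= e / 2.
    by rewrite -ler_pdivlMr // mulrAC.
  have : e' * B * nu h <= e / 2 * nu h by rewrite ler_wpM2r.
  have : 0 <= e' * nu h by rewrite mulr_ge0 // ltW.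
  by rewrite /B; nra.
by rewrite (le_trans (nmD _ _)) //; lra.
Qed.

Lemma diffat_comp (D : zmodType) (nu : D -> R) (q : C -> C) (g : D -> C) z (L : D -> C)
    (K : R) (c : C) :
  (forall h, 0 <= nu h) -> (forall h, nm (L h) <= K * nu h) ->
  diffat nu g z L -> diffat (@nm R C) q (g z) ( *%R c) ->
  diffat nu (q \o g) z (fun h => c * L h).
Proof.
move=> nu0 hL dg dq.
wlog K0 : K hL / 0 <= K.
  move=> W; apply: (W `|K|) => // h.
  by rewrite (le_trans (hL h)) // ler_wpM2r // ler_norm.
move=> e e0; have c0 := nm_ge0 c.
have e1 : 0 < e / 2 / (K + 1) by rewrite !divr_gt0 //; lra.
have [d d0 hd] := dq _ e1.
have e2 : 0 < Num.min 1 (e / 2 / (nm c + 1)).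
  by rewrite lt_min ltr01 !divr_gt0 //; lra.
set e' := Num.min _ _ in e2.
have e'1 : e' <= 1 by rewrite ge_min lexx.
have e'e : e' <= e / 2 / (nm c + 1) by rewrite ge_min lexx orbT.
have [d' d'0 hd'] := dg _ e2.
exists (Num.min d' (d / (K + 1))) => [|h].
  by rewrite lt_min d'0 divr_gt0 //; lra.
rewrite lt_min ltr_pdivlMr; last by lra.
move=> /andP[/hd' h1 h2] /=.
set u := g (z + h) - g z in h1.
have n0 := nu0 h.
have nu1 : nm u <= (K + 1) * nu h.
  have := nmD (u - L h) (L h); rewrite subrK => /le_trans; apply.
  have : e' * nu h <= 1 * nu h by rewrite ler_wpM2r.
  by have := hL h; lra.
have ud : nm u < d by apply: le_lt_trans nu1 _; rewrite mulrC.
have := hd _ ud; rewrite {1}/u subrKC => h3.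
have -> : q (g (z + h)) - q (g z) - c * L h =
  (q (g (z + h)) - q (g z) - c * u) + c * (u - L h) by ring.
rewrite (le_trans (nmD _ _)) // nmM.
have i1 : nm c * nm (u - L h) <= e / 2 * nu h.
  have /le_trans : nm c * nm (u - L h) <= nm c * (e' * nu h) by rewrite ler_wpM2l.
  apply; rewrite mulrA ler_wpM2r //.
  have : (nm c + 1) * e' <= e / 2 by rewrite mulrC -ler_pdivlMr //; lra.
  by rewrite mulrDl mul1r; lra.
have i2 : e / 2 / (K + 1) * nm u <= e / 2 * nu h.
  have /le_trans : e / 2 / (K + 1) * nm u <= e / 2 / (K + 1) * ((K + 1) * nu h).
    by rewrite ler_wpM2l // ltW.
  by apply; rewrite mulrA divfK //; apply: lt0r_neq0; lra.
by lra.
Qed.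

Lemma diffat_path (D V : zmodType) (nu : D -> R) (mu : V -> R) (g : V -> C) (L : V -> C)
    (p : D -> V) t (l : D -> V) (K : R) :
  (forall h, 0 <= nu h) ->
  (forall h, p (t + h) = p t + l h) -> (forall h, mu (l h) <= K * nu h) ->
  diffat mu g (p t) L -> diffat nu (g \o p) t (L \o l).
Proof.
move=> nu0 pE hK dg.
wlog K0 : K hK / 0 <= K.
  move=> W; apply: (W `|K|) => // h.
  by rewrite (le_trans (hK h)) // ler_wpM2r // ler_norm.
move=> e e0.
have K1 : 0 < K + 1 by lra.
have [d d0 hd] := dg (e / (K + 1)) ltac:(rewrite divr_gt0 //).
exists (d / (K + 1)); first by rewrite divr_gt0.
move=> h hh /=; rewrite pE.
have lh : mu (l h) <= (K + 1) * nu h.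
  by rewrite (le_trans (hK h)) // ler_wpM2r //; lra.
rewrite (le_trans (hd _ _)) //.
  by rewrite (le_lt_trans lh) // mulrC -ltr_pdivlMr.
rewrite mulrAC ler_pdivrMr // -mulrA ler_wpM2l //; first exact: ltW.
by rewrite mulrC.
Qed.

Lemma diffat_cont (D : zmodType) (nu : D -> R) (g : D -> C) z L (K : R) :
  (forall h, 0 <= nu h) -> (forall h, nm (L h) <= K * nu h) ->
  diffat nu g z L -> forall e : R, 0 < e ->
  exists2 d : R, 0 < d & forall h, nu h < d -> nm (g (z + h) - g z) < e.
Proof.
move=> nu0 hL dg.
wlog K0 : K hL / 0 <= K.
  move=> W; apply: (W `|K|) => // h.
  by rewrite (le_trans (hL h)) // ler_wpM2r // ler_norm.
move=> e e0; have [d d0 hd] := dg 1 ltr01.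
have K1 : 0 < K + 1 by lra.
exists (Num.min d (e / (K + 1))) => [|h]; first by rewrite lt_min d0 divr_gt0.
rewrite lt_min ltr_pdivlMr // => /andP[/hd h1 h2].
have := nmD (g (z + h) - g z - L h) (L h); rewrite subrK => /le_lt_trans; apply.
by have := hL h; nra.
Qed.

Local Notation dR := (diffat (D := R) (@Num.norm R R)).
Local Notation dC := (diffat (D := C) (@nm R C)).

Lemma dC_unique (g : C -> C) z c c' : dC g z ( *%R c) -> dC g z ( *%R c') -> c = c'.
Proof.
move=> h1 h2; apply/eqP; rewrite -subr_eq0; apply/negPn/negP => /nm_gt0 n0.
have [d d0 hd] := h1 _ (divr_gt0 n0 (ltr0n R 4)).
have [d' d'0 hd'] := h2 _ (divr_gt0 n0 (ltr0n R 4)).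
pose r := Num.min d d' / 2.
have r0 : 0 < r by rewrite /r divr_gt0 // lt_min d0.
have rd : r < d /\ r < d'.
  have : Num.min d d' <= d by rewrite ge_min lexx.
  have : Num.min d d' <= d' by rewrite ge_min lexx orbT.
  by move: r0; rewrite /r; lra.
have nr : nm (r%:C : C) = r by rewrite nmR gtr0_norm.
have := hd r%:C; have := hd' r%:C; rewrite nr => /(_ rd.2) i1 /(_ rd.1) i2.
have := nm_tri (g (z + r%:C) - g z) (c * r%:C) (c' * r%:C).
by rewrite -mulrBl nmM nr nmC; nra.
Qed.

(** Mean value inequality.  For every slack r > 0 the bound with K + r holds locally and
is preserved when adjacent intervals are joined. *)
Lemma mvt_real (H : R -> C) (h : R -> C) (a b K : R) : a <= b ->
  (forall x, a <= x <= b -> dR H x (fun u => u%:C * h x)) ->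
  (forall x, a <= x <= b -> nm (h x) <= K) ->
  nm (H b - H a) <= K * (b - a).
Proof.
move=> ab dH hK; apply/ler_addgt0Pr => e e0.
pose r := e / (b - a + 1).
have r0 : 0 < r by rewrite /r divr_gt0 //; lra.
suff : nm (H (a + (b - a)) - H a) <= (K + r) * (b - a).
  rewrite subrKC; have : r * (b - a) <= e.
    by rewrite /r mulrAC ler_pdivrMr; [rewrite ler_wpM2l //; lra|lra].
  lra.
apply: (@bisection1 R (fun s l => nm (H (s + l) - H s) <= (K + r) * l)); first by lra.
  move=> s l l0 h1 h2; have := nm_tri (H (s + l / 2)) (H (s + l)) (H s).
  by move: h2; rewrite -addrA -splitr; lra.
move=> x; rewrite subrKC => xab; have [d d0 hd] := dH x xab _ r0.
exists d => // s l /andP[l0 ld] /andP[sx xs] _ _.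
have key y : `|y - x| < d -> nm (H y - H x) <= (K + r) * `|y - x|.
  move=> yx; have := hd (y - x) yx; rewrite subrKC => i1.
  have := nmD (H y - H x - (y - x)%:C * h x) ((y - x)%:C * h x); rewrite subrK.
  move=> /le_trans; apply; rewrite nmM nmR.
  have : `|y - x| * nm (h x) <= `|y - x| * K by rewrite ler_wpM2l // hK.
  lra.
have := nm_tri (H x) (H (s + l)) (H s).
have := key (s + l); have := key s.
by rewrite distrC [nm (H s - _)]nmC !ger0_norm; lra.
Qed.

End differentials.

(** * Integrals of complex functions of a real variable *)

Section primitives.
Context {R : realType}.
Local Notation C := R[i].
Local Notation dR := (diffat (D := R) (@Num.norm R R)).

Definition contR (h : R -> C) := forall t (e : R), 0 < e ->
  exists2 d : R, 0 < d & forall u, `|u| < d -> nm (h (t + u) - h t) < e.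

Lemma is_derive_diff (f : R -> R) (x l : R) : is_derive x 1 f l ->
  forall e, 0 < e -> exists2 d, 0 < d &
    forall u, `|u| < d -> `|f (x + u) - f x - u * l| <= e * `|u|.
Proof.
move=> [df fl] e e0; move: df => /cvg_ex[/= k hk].
have lE : k = l by rewrite -fl /derive; apply/esym/cvg_lim.
move: hk => /cvgrPdist_le /(_ e e0); rewrite near_withinE.
move=> /nbhs_ballP[d /= d0 hd]; exists d => // u ud.
have [->|u0] := eqVneq u 0; first by rewrite addr0 mul0r !subrr normr0 mulr0.
have := hd u; rewrite /ball /= sub0r normrN => /(_ ud u0).
rewrite [u *: 1]mulr1 [u + x]addrC lE => H.
have -> : f (x + u) - f x - u * l = - (u * (l - u^-1 *: (f (x + u) - f x))).
  by rewrite mulrBr /GRing.scale /= mulrA mulfV // mul1r; ring.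
by rewrite normrN normrM mulrC ler_wpM2r.
Qed.

(** The fundamental theorem of calculus; the base point A has to lie to the left of the
points considered. *)
Lemma real_primitive (f : R -> R) (A : R) : continuous f ->
  exists F : R -> R, forall x, A < x -> forall e, 0 < e -> exists2 d, 0 < d &
    forall u, `|u| < d -> `|F (x + u) - F x - u * f x| <= e * `|u|.
Proof.
move=> fc.
pose F (x : R) : R := (\int[@lebesgue_measure R]_(t in `[A, x]) f t)%R.
exists F => x Ax.
have [||dF Fx] := @continuous_FTC1_closed R f A x (x + 1) _ _ Ax (fc x).
- by rewrite ltrDl.
- apply: continuous_compact_integrable; first exact: segment_compact.
  exact: continuous_subspaceT.
by apply: is_derive_diff; split; [exact: dF|rewrite -derive1E; exact: Fx].
Qed.

Lemma contR_continuous (h : R -> R) :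
  (forall t (e : R), 0 < e ->
    exists2 d : R, 0 < d & forall u, `|u| < d -> `|h (t + u) - h t| < e) ->
  continuous h.
Proof.
move=> hc t; apply/cvgrPdist_lt => e e0; have [d d0 hd] := hc t e e0.
apply/nbhs_ballP; exists d => //= u; rewrite /ball /= => tu.
by have := hd (u - t); rewrite subrKC distrC [in X in _ -> X]distrC => /(_ tu).
Qed.

Lemma complex_primitive (h : R -> C) (A : R) : contR h ->
  exists H : R -> C, forall x, A < x -> dR H x (fun u => u%:C * h x).
Proof.
move=> hc.
have [F hF] : exists F : R -> R, forall x, A < x -> forall e, 0 < e -> exists2 d, 0 < d &
    forall u, `|u| < d -> `|F (x + u) - F x - u * complex.Re (h x)| <= e * `|u|.
  apply: real_primitive; apply: contR_continuous => t e e0.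
  have [d d0 hd] := hc t e e0; exists d => // u /hd; apply: le_lt_trans.
  by apply: le_trans (nm_Re _); case: (h (t + u)) (h t) => [? ?] [? ?].
have [G hG] : exists F : R -> R, forall x, A < x -> forall e, 0 < e -> exists2 d, 0 < d &
    forall u, `|u| < d -> `|F (x + u) - F x - u * complex.Im (h x)| <= e * `|u|.
  apply: real_primitive; apply: contR_continuous => t e e0.
  have [d d0 hd] := hc t e e0; exists d => // u /hd; apply: le_lt_trans.
  by apply: le_trans (nm_Im _); case: (h (t + u)) (h t) => [? ?] [? ?].
exists (fun x => F x +i* G x) => x Ax e e0.
have e2 : 0 < e / 2 by lra.
have [d d0 hd] := hF x Ax _ e2; have [d' d'0 hd'] := hG x Ax _ e2.
exists (Num.min d d') => [|u]; first by rewrite lt_min d0.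
rewrite lt_min => /andP[/hd h1 /hd' h2].
apply: le_trans (nm_ReIm _) _; case: (h x) h1 h2 => a b /= h1 h2.
by rewrite !mul0r subr0 addr0; lra.
Qed.

Definition is_primitive (h : R -> C) (a b : R) (H : R -> C) :=
  forall x, a <= x <= b -> dR H x (fun u => u%:C * h x).

Lemma primitive_exists (h : R -> C) a b : contR h -> exists H, is_primitive h a b H.
Proof.
move=> /complex_primitive - /(_ (a - 1))[H hH]; exists H => x /andP[ax _].
by apply: hH; lra.
Qed.

(** The integral is defined through primitives, so that linearity and additivity are
immediate and bounds follow from the mean value inequality. *)
Definition cint (h : R -> C) (a b : R) : C :=
  if pselect (exists H, is_primitive h a b H) is left e
  then projT1 (cid e) b - projT1 (cid e) a else 0.

Lemma primitive_lin (x y : C) h k a b H K : is_primitive h a b H -> is_primitive k a b K ->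
  is_primitive (fun t => x * h t + y * k t) a b (fun t => x * H t + y * K t).
Proof.
move=> hH kK t tab.
apply: (diffat_ext (r := 1) _ _ _ _ (diffat_lin x y _ (hH t tab) (kK t tab))) => //.
  by rewrite normr0.
by move=> u; rewrite /=; ring.
Qed.

(** Two primitives differ by a constant, by the mean value inequality with K = 0. *)
Lemma cintE h a b H : a <= b -> is_primitive h a b H -> cint h a b = H b - H a.
Proof.
move=> ab hH; rewrite /cint; case: pselect => [e|[]]; last by exists H.
case: cid => K /= hK; apply/eqP; rewrite -subr_eq0; apply/eqP/nm0_eq0.
apply/eqP; rewrite eq_le nm_ge0 andbT.
have -> : K b - K a - (H b - H a) = (1 * K b + -1 * H b) - (1 * K a + -1 * H a) by ring.
rewrite -(mul0r (b - a)).
apply: (mvt_real (H := fun t => 1 * K t + -1 * H t) ab (primitive_lin 1 (-1) hK hH)).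
by move=> t _; rewrite -mulrDl subrr mul0r nm0.
Qed.

Lemma cint_split h a b c : contR h -> a <= b -> b <= c ->
  cint h a c = cint h a b + cint h b c.
Proof.
move=> hc ab bc; have ac := le_trans ab bc.
have [H hH] := primitive_exists a c hc.
rewrite !(cintE (H := H)) //; first by ring.
- by move=> x /andP[xb xc]; apply: hH; rewrite xc (le_trans ab).
- by move=> x /andP[xb xc]; apply: hH; rewrite xb (le_trans xc).
Qed.

Lemma cint_lin (x y : C) h k a b : contR h -> contR k -> a <= b ->
  cint (fun t => x * h t + y * k t) a b = x * cint h a b + y * cint k a b.
Proof.
move=> hc kc ab.
have [H hH] := primitive_exists a b hc; have [K hK] := primitive_exists a b kc.
rewrite (cintE ab hH) (cintE ab hK) (cintE ab (primitive_lin x y hH hK)).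
by ring.
Qed.

Lemma cint_bound h a b (K : R) : contR h -> a <= b ->
  (forall t, a <= t <= b -> nm (h t) <= K) -> nm (cint h a b) <= K * (b - a).
Proof.
move=> hc ab hK; have [H hH] := primitive_exists a b hc.
by rewrite (cintE ab hH); exact: mvt_real hH hK.
Qed.

Lemma primitive_affine (c d : C) a b :
  is_primitive (fun t => c + t%:C * d) a b (fun t => t%:C * c + (t ^+ 2 / 2)%:C * d).
Proof.
move=> x _ e e0; exists (e / (nm d + 1)).
  by rewrite divr_gt0 //; have := nm_ge0 d; lra.
move=> u; rewrite ltr_pdivlMr; last by have := nm_ge0 d; lra.
move=> hu.
have -> : (x + u)%:C * c + ((x + u) ^+ 2 / 2)%:C * d - (x%:C * c + (x ^+ 2 / 2)%:C * d) -
   u%:C * (c + x%:C * d) = (u ^+ 2 / 2)%:C * d.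
  by rewrite !(rmorphM, rmorphXn, rmorphD, fmorphV, rmorph_nat); field.
rewrite nmM nmR ger0_norm; last by rewrite mulr_ge0 ?sqr_ge0.
rewrite -real_normK ?num_real // expr2.
by have := nm_ge0 d; have := normr_ge0 u; nra.
Qed.

Lemma cint_affine (c d : C) a b : a <= b ->
  cint (fun t => c + t%:C * d) a b = (b - a)%:C * c + ((b ^+ 2 - a ^+ 2) / 2)%:C * d.
Proof.
move=> ab; rewrite (cintE ab (@primitive_affine c d a b)).
by rewrite !(rmorphM, rmorphXn, rmorphD, rmorphN, fmorphV, rmorph_nat); field.
Qed.

Lemma contR_lin (x y : C) h k : contR h -> contR k -> contR (fun t => x * h t + y * k t).
Proof.
move=> hc kc t e e0; have [x0 y0] := (nm_ge0 x, nm_ge0 y).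
have B : 0 < nm x + nm y + 1 by lra.
have [d d0 hd] := hc t (e / (nm x + nm y + 1)) ltac:(rewrite divr_gt0 //).
have [d' d'0 hd'] := kc t (e / (nm x + nm y + 1)) ltac:(rewrite divr_gt0 //).
exists (Num.min d d') => [|u]; first by rewrite lt_min d0.
rewrite lt_min => /andP[/hd h1 /hd' h2].
have -> : x * h (t + u) + y * k (t + u) - (x * h t + y * k t) =
  x * (h (t + u) - h t) + y * (k (t + u) - k t) by ring.
apply: le_lt_trans (nmD _ _) _; rewrite !nmM.
move: h1 h2; rewrite !ltr_pdivlMr // => h1 h2.
by have := nm_ge0 (h (t + u) - h t); have := nm_ge0 (k (t + u) - k t); nra.
Qed.

Lemma contR_affine (c d : C) : contR (fun t => c + t%:C * d).
Proof.
move=> t e e0; have d0 := nm_ge0 d.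
exists (e / (nm d + 1)) => [|u]; first by rewrite divr_gt0 //; lra.
rewrite ltr_pdivlMr; last by lra.
have -> : c + (t + u)%:C * d - (c + t%:C * d) = u%:C * d by rewrite rmorphD /=; ring.
by rewrite nmM nmR; have := normr_ge0 u; nra.
Qed.

Lemma diff_contR (h : R -> C) : (forall t, exists c, dR h t (fun u => u%:C * c)) -> contR h.
Proof.
move=> dh t; have [c hc] := dh t.
apply: (diffat_cont (K := nm c) _ _ hc) => // u.
by rewrite nmM nmR mulrC.
Qed.

End primitives.

(** * Goursat's theorem on rectangles *)

Section goursat.
Context {R : realType}.
Local Notation C := R[i].

Lemma complex_mk (x y : R) : x +i* y = x%:C + 'i * y%:C.
Proof. exact: complexE. Qed.

(** The integral of Q(x + iy) dz along the boundary of [s, s+a] x [t, t+b]. *)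
Definition boundary_int (Q : R -> R -> C) (s a t b : R) : C :=
  cint (Q^~ t) s (s + a) + 'i * cint (Q (s + a)) t (t + b)
  - cint (Q^~ (t + b)) s (s + a) - 'i * cint (Q s) t (t + b).

Definition separately_continuous (Q : R -> R -> C) :=
  (forall t, contR (Q^~ t)) /\ (forall s, contR (Q s)).

Lemma boundary_int_split Q s a t b : separately_continuous Q -> 0 <= a -> 0 <= b ->
  boundary_int Q s a t b =
  boundary_int Q s (a / 2) t (b / 2) + boundary_int Q (s + a / 2) (a / 2) t (b / 2) +
  boundary_int Q s (a / 2) (t + b / 2) (b / 2) +
  boundary_int Q (s + a / 2) (a / 2) (t + b / 2) (b / 2).
Proof.
move=> [c1 c2] a0 b0; rewrite /boundary_int -!addrA -!splitr !addrA.
have [a1 a2 b1 b2] : [/\ s <= s + a / 2, s + a / 2 <= s + a, t <= t + b / 2 &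
  t + b / 2 <= t + b] by split; lra.
rewrite (cint_split (c1 t) a1 a2) (cint_split (c1 (t + b)) a1 a2).
rewrite (cint_split (c2 s) b1 b2) (cint_split (c2 (s + a)) b1 b2).
ring.
Qed.

Lemma boundary_int_affine (c D : C) s a t b : 0 <= a -> 0 <= b ->
  boundary_int (fun x y => c + D * (x +i* y)) s a t b = 0.
Proof.
move=> a0 b0; rewrite /boundary_int.
have E1 y : (fun x => c + D * (x +i* y)) = (fun x => (c + D * ('i * y%:C)) + x%:C * D).
  by apply/funext => x; rewrite complex_mk; ring.
have E2 x : (fun y => c + D * (x +i* y)) = (fun y => (c + D * x%:C) + y%:C * ('i * D)).
  by apply/funext => y; rewrite complex_mk; ring.
rewrite !E1 !E2 !cint_affine ?lerDl //.
rewrite !(rmorphM, rmorphXn, rmorphD, rmorphN, fmorphV, rmorph_nat).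
have i2 : 'i * 'i = -1 :> C by rewrite -expr2 sqr_i.
by field: i2.
Qed.

Lemma boundary_int_lin (x y : C) Q Q' s a t b :
  separately_continuous Q -> separately_continuous Q' -> 0 <= a -> 0 <= b ->
  boundary_int (fun u v => x * Q u v + y * Q' u v) s a t b =
  x * boundary_int Q s a t b + y * boundary_int Q' s a t b.
Proof.
move=> [c1 c2] [c1' c2'] a0 b0; rewrite /boundary_int.
by rewrite !cint_lin ?lerDl //; ring.
Qed.

Lemma boundary_int_bound Q s a t b (K : R) : separately_continuous Q -> 0 <= a -> 0 <= b ->
  (forall x y, s <= x <= s + a -> t <= y <= t + b -> nm (Q x y) <= K) ->
  nm (boundary_int Q s a t b) <= 2 * K * (a + b).
Proof.
move=> [c1 c2] a0 b0 hK; rewrite /boundary_int.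
have H1 y : t <= y <= t + b -> nm (cint (Q^~ y) s (s + a)) <= K * a.
  move=> ty; have {2}-> : a = s + a - s by lra.
  by apply: cint_bound => //; [lra|move=> x xs; exact: hK].
have H2 x : s <= x <= s + a -> nm (cint (Q x) t (t + b)) <= K * b.
  move=> sx; have {2}-> : b = t + b - t by lra.
  by apply: cint_bound => //; [lra|move=> y yt; exact: hK].
have i1 := H1 t ltac:(lra); have i2 := H1 (t + b) ltac:(lra).
have i3 := H2 s ltac:(lra); have i4 := H2 (s + a) ltac:(lra).
have i5 : nm ('i * cint (Q (s + a)) t (t + b)) <= K * b by rewrite nmM nmi mul1r.
have i6 : nm ('i * cint (Q s) t (t + b)) <= K * b by rewrite nmM nmi mul1r.
do 3 (apply: le_trans (nmD _ _) _; rewrite ?nmN -lerBrDr).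
by lra.
Qed.

(** Goursat's theorem.  The boundary integral is additive under subdivision and vanishes on
affine functions, so on a small rectangle around a point of differentiability it
is at most e (a^2 + b^2), which is the sum of the same bounds for the four quarters. *)
Lemma goursat Q s a t b : separately_continuous Q -> 0 <= a -> 0 <= b ->
  (forall x y, s <= x <= s + a -> t <= y <= t + b -> exists D : C, forall e : R, 0 < e ->
    exists2 d : R, 0 < d & forall x' y', s <= x' <= s + a -> t <= y' <= t + b ->
      `|x' - x| < d -> `|y' - y| < d ->
      nm (Q x' y' - Q x y - D * ((x' - x) +i* (y' - y))) <= e * (`|x' - x| + `|y' - y|)) ->
  boundary_int Q s a t b = 0.
Proof.
move=> cQ a0 b0 dQ; apply/nm0_eq0/eqP; rewrite eq_le nm_ge0 andbT.
have S0 : 0 <= a ^+ 2 + b ^+ 2 by rewrite addr_ge0 ?sqr_ge0.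
apply/ler_addgt0Pr => e0 e00; rewrite add0r.
pose e := e0 / (a ^+ 2 + b ^+ 2 + 1).
have e_gt0 : 0 < e by rewrite divr_gt0 //; lra.
suff /le_trans : nm (boundary_int Q s a t b) <= e * (a ^+ 2 + b ^+ 2).
  apply; rewrite /e mulrAC ler_pdivrMr; last lra.
  by rewrite ler_wpM2l //; lra.
apply: (@bisection2 R (fun s a t b => nm (boundary_int Q s a t b) <= e * (a ^+ 2 + b ^+ 2))) => //.
  move=> {dQ S0 e_gt0} s' a' t' b' a'0 b'0 h1 h2 h3 h4.
  rewrite boundary_int_split //.
  do 3 (apply: le_trans (nmD _ _) _; rewrite -lerBrDr).
  have sq4 (z : R) : (z / 2) ^+ 2 = z ^+ 2 / 4 by field.
  by move: h1 h2 h3 h4; rewrite !sq4; lra.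
move=> x y xs yt; have [D hD] := dQ x y xs yt.
have [d d0 hd] := hD (e / 4) ltac:(lra).
exists (d / (a + b + 1)); first by rewrite divr_gt0 //; lra.
move=> k s' t'; rewrite ltr_pdivlMr; last by lra.
have p0 : 0 <= 2^-1 ^+ k :> R by rewrite exprn_ge0 // invr_ge0.
move: p0; set p := _ ^+ k => p0 pd.
have : a * p < d /\ b * p < d by split; nra.
have : 0 <= a * p /\ 0 <= b * p by split; rewrite mulr_ge0.
move: (a * p) (b * p) => a' b' [a'0 b'0] [a'd b'd] xs' yt' ss' sa tt' tb.
pose A x' y' := (Q x y - D * (x +i* y)) + D * (x' +i* y').
have cA : separately_continuous A.
  split=> z u r r0.
    have [d' d'0 h'] := contR_affine (Q x y - D * (x +i* y) + D * ('i * z%:C)) D u r0.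
    exists d' => // v /h'; rewrite /A !complex_mk !rmorphD.
    by congr (nm _ < _); ring.
  have [d' d'0 h'] := contR_affine (Q x y - D * (x +i* y) + D * z%:C) ('i * D) u r0.
  exists d' => // v /h'; rewrite /A !complex_mk !rmorphD.
  by congr (nm _ < _); ring.
have B0 := boundary_int_affine (Q x y - D * (x +i* y)) D s' t' a'0 b'0.
have := boundary_int_lin 1 (-1) s' t' cQ cA a'0 b'0.
rewrite B0 mulr0 addr0 mul1r => <-.
have cQA : separately_continuous (fun u v => 1 * Q u v + -1 * A u v).
  by case: cQ cA => q1 q2 [A1 A2]; split => z; exact: contR_lin.
have := @boundary_int_bound _ s' a' t' b' (e / 4 * (a' + b')) cQA a'0 b'0.
move=> /(_ _)/le_trans; apply; last by have := sqr_ge0 (a' - b'); nra.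
move=> x' y' hx' hy'.
have -> : 1 * Q x' y' + -1 * A x' y' = Q x' y' - Q x y - D * ((x' - x) +i* (y' - y)).
  have -> : (x' - x) +i* (y' - y) = (x' +i* y') - (x +i* y) by [].
  by rewrite /A; ring.
have sub (u v z w l : R) : z <= u <= z + w -> z <= v <= z + w -> w < l ->
    `|u - v| <= w /\ `|u - v| < l.
  move=> {hD hd} /andP[u1 u2] /andP[v1 v2] wl.
  have uw : `|u - v| <= w by rewrite ler_distl; apply/andP; split; lra.
  by split=> //; exact: le_lt_trans wl.
have [ax ax'] := sub x' x s' a' d hx' xs' a'd.
have [ay ay'] := sub y' y t' b' d hy' yt' b'd.
have widen (u z w z' w' : R) : z <= u <= z + w -> z' <= z -> z + w <= z' + w' ->
    z' <= u <= z' + w'.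
  by move=> /andP[u1 u2] z1 z2; rewrite (le_trans z1 u1) (le_trans u2 z2).
apply: le_trans (hd _ _ (widen _ _ _ _ _ hx' ss' sa) (widen _ _ _ _ _ hy' tt' tb) ax' ay') _.
by apply: ler_wpM2l; [exact/ltW/divr_gt0|exact: lerD].
Qed.

End goursat.

(** * Circle means *)

Section circle.
Context {R : realType}.
Local Notation C := R[i].
Local Notation dC := (diffat (D := C) (@nm R C)).
Local Notation dR := (diffat (D := R) (@Num.norm R R)).

Definition cis (t : R) : C := cos t +i* sin t.

Lemma nm_cis t : nm (cis t) = 1.
Proof. by rewrite nmE /= cos2Dsin2 sqrtr1. Qed.

Definition norm1 (p : R * R) : R := `|p.1| + `|p.2|.
Lemma norm1_ge0 p : 0 <= norm1 p. Proof. by rewrite addr_ge0. Qed.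

(** The complex exponential exp(s + it). *)
Definition polar (p : R * R) : C := (expR p.1)%:C * cis p.2.

Lemma nm_polar p : nm (polar p) = expR p.1.
Proof. by rewrite nmM nm_cis mulr1 nmR gtr0_norm // expR_gt0. Qed.

Lemma diff_cis (t : R) : dR cis t (fun u => u%:C * ('i * cis t)).
Proof.
move=> e e0; have e2 : 0 < e / 2 by lra.
have [d d0 hd] := is_derive_diff (is_derive_cos t) e2.
have [d' d'0 hd'] := is_derive_diff (is_derive_sin t) e2.
exists (Num.min d d') => [|u]; first by rewrite lt_min d0.
rewrite lt_min => /andP[/hd h1 /hd' h2].
apply: le_trans (nm_ReIm _) _; rewrite /cis /=.
by rewrite !(mul0r, mul1r, subr0, addr0, sub0r, add0r, mulrN); move: h1; rewrite mulrN; lra.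
Qed.

Lemma diff_polar p : diffat norm1 polar p (fun h => (h.1 +i* h.2) * polar p).
Proof.
have d1 : diffat norm1 (fun p : R * R => (expR p.1)%:C) p (fun h => (h.1 * expR p.1)%:C).
  move=> e e0; have [d d0 hd] := is_derive_diff (is_derive_expR p.1) e0.
  exists d => // h; rewrite /norm1 => hp.
  have {}hp : `|h.1| < d by have := normr_ge0 h.2; lra.
  rewrite /= -!rmorphB nmR; apply: le_trans (hd _ hp) _.
  by apply: ler_wpM2l; [exact: ltW|rewrite lerDl].
have d2 : diffat norm1 (fun p : R * R => cis p.2) p (fun h => h.2%:C * ('i * cis p.2)).
  apply: (@diffat_path _ _ _ norm1 (@Num.norm R R) cis
    (fun u : R => u%:C * ('i * cis p.2)) snd p snd 1) => //.
  - exact: norm1_ge0.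
  - by move=> h; rewrite mul1r /norm1 lerDr.
  - exact: diff_cis.
have b1 h : nm (h.1 * expR p.1)%:C <= (expR p.1 + 1) * norm1 h.
  rewrite nmR normrM (gtr0_norm (expR_gt0 _)) mulrC.
  by apply: ler_pM; rewrite ?expR_ge0 // ?/norm1 lerDl.
have b2 (h : R * R) : nm (h.2%:C * ('i * cis p.2)) <= (expR p.1 + 1) * norm1 h.
  rewrite !nmM nmi nm_cis nmR !mulr1 -[leLHS]mul1r.
  by apply: ler_pM => //; rewrite /norm1 lerDr ?expR_ge0.
apply: (diffat_ext (r := 1) _ _ _ _ (diffat_mul norm1_ge0 b1 b2 d1 d2)) => //.
  by rewrite /norm1 /= normr0 addr0.
by move=> h; rewrite /polar complex_mk rmorphM /=; ring.
Qed.


Local Notation circle r := (fun t : R => r%:C * cis t).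

Lemma diff_inv (z : C) : z != 0 -> dC (@GRing.inv C) z ( *%R (- z ^- 2)).
Proof.
move=> z0 e e0; have n0 := nm_gt0 z0.
exists (Num.min (nm z / 2) (e * nm z ^+ 3 / 2)).
  by rewrite lt_min !divr_gt0 // ?mulr_gt0 // exprn_gt0.
move=> h; rewrite lt_min => /andP[h1 h2].
have zh : nm z / 2 <= nm (z + h).
  by have := nmB (z + h) h; rewrite addrK; lra.
have zh0 : z + h != 0.
  by apply/eqP => zh0; rewrite zh0 nm0 in zh; lra.
have -> : (z + h)^-1 - z^-1 - - z ^- 2 * h = h ^+ 2 / (z ^+ 2 * (z + h)).
  by field; rewrite zh0 z0.
rewrite nmM nmV nmM !nmX ler_pdivrMr; last first.
  by rewrite mulr_gt0 // ?exprn_gt0 //; lra.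
have : e * nm z ^+ 3 / 2 <= e * (nm z ^+ 2 * nm (z + h)).
  rewrite -mulrA ler_wpM2l //; first exact: ltW.
  by rewrite exprSr -mulrA ler_wpM2l // exprn_ge0 // ltW.
by have := nm_ge0 h; rewrite expr2; nra.
Qed.

Lemma dC_mul (f g : C -> C) z c d : dC f z ( *%R c) -> dC g z ( *%R d) ->
  dC (fun w => f w * g w) z ( *%R (c * g z + f z * d)).
Proof.
move=> df dg.
have b1 h : nm (c * h) <= (nm c + nm d) * nm h.
  by rewrite nmM ler_wpM2r ?nm_ge0 // lerDl nm_ge0.
have b2 h : nm (d * h) <= (nm c + nm d) * nm h.
  by rewrite nmM ler_wpM2r ?nm_ge0 // lerDr nm_ge0.
apply: (diffat_ext (r := 1) _ _ _ _ (diffat_mul (@nm_ge0 _ _) b1 b2 df dg)) => //.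
  by rewrite nm0.
by move=> h /=; ring.
Qed.

Lemma dC_lin (x y : C) (f g : C -> C) z c d : dC f z ( *%R c) -> dC g z ( *%R d) ->
  dC (fun w => x * f w + y * g w) z ( *%R (x * c + y * d)).
Proof.
move=> df dg.
apply: (diffat_ext (r := 1) _ _ _ _ (diffat_lin x y (@nm_ge0 _ _) df dg)) => //.
  by rewrite nm0.
by move=> h /=; ring.
Qed.

Lemma dC_cst (k : C) z : dC (fun=> k) z ( *%R 0).
Proof.
move=> e e0; exists 1 => // h _; rewrite mul0r subr0 subrr nm0.
by rewrite mulr_ge0 ?nm_ge0 // ltW.
Qed.

Lemma dC_id z : dC id z ( *%R 1).
Proof.
move=> e e0; exists 1 => // h _; rewrite mul1r [z + h]addrC addrK subrr nm0.
by rewrite mulr_ge0 ?nm_ge0 // ltW.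
Qed.

Definition cdiff (q : C -> C) z := exists c, dC q z ( *%R c).

Lemma circle_contR (q : C -> C) (r : R) : 0 <= r -> (forall z, nm z = r -> cdiff q z) ->
  contR (q \o circle r).
Proof.
move=> r0 dq; apply: diff_contR => t.
have [|c hc] := dq (r%:C * cis t).
  by rewrite nmM nm_cis mulr1 nmR ger0_norm.
exists (c * (r%:C * ('i * cis t))).
have d1 : dR (circle r) t (fun u => r%:C * (u%:C * ('i * cis t))).
  apply: (diffat_ext (r := 1) _ _ _ _
    (diffat_lin r%:C 0 (@normr_ge0 _ _) (@diff_cis t) (@diff_cis t))) => //.
  - by rewrite normr0.
  - by move=> h _; rewrite mul0r addr0.
  - by move=> h; rewrite mul0r addr0.
have b1 u : nm (r%:C * (u%:C * ('i * cis t))) <= r * `|u|.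
  by rewrite !nmM nmi nm_cis !mulr1 !nmR (ger0_norm r0).
apply: (diffat_ext (r := 1) _ _ _ _ (diffat_comp (@normr_ge0 _ _) b1 d1 hc)) => //.
  by rewrite normr0.
by move=> h; ring.
Qed.

Definition cmean (q : C -> C) (r : R) : C :=
  cint (q \o circle r) 0 (pi *+ 2) / (pi *+ 2)%:C.

Lemma pi2_gt0 : 0 < pi *+ 2 :> R. Proof. by rewrite mulrn_wgt0 // pi_gt0. Qed.

Lemma cmean_lin (x y : C) f g r : contR (f \o circle r) -> contR (g \o circle r) ->
  cmean (fun z => x * f z + y * g z) r = x * cmean f r + y * cmean g r.
Proof.
move=> cf cg; rewrite /cmean (cint_lin x y cf cg) ?ltW ?pi2_gt0 //.
by rewrite mulrDl !mulrA.
Qed.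

Lemma cmean_cst k r : cmean (fun=> k) r = k.
Proof.
have -> : cmean (fun=> k) r = cint (fun t => k + t%:C * 0) 0 (pi *+ 2) / (pi *+ 2)%:C.
  by congr (cint _ _ _ / _); apply/funext => t; rewrite mulr0 addr0.
rewrite cint_affine ?ltW ?pi2_gt0 // mulr0 addr0 subr0 mulrC mulKf //.
by apply/eqP => -[/eqP]; rewrite gt_eqF // pi2_gt0.
Qed.

Lemma cmean_bound f r (K : R) : 0 <= r -> contR (f \o circle r) ->
  (forall z, nm z = r -> nm (f z) <= K) -> nm (cmean f r) <= K.
Proof.
move=> r0 cf fK; rewrite nmM nmV nmR (gtr0_norm pi2_gt0) ler_pdivrMr ?pi2_gt0 //.
rewrite -{2}[pi *+ 2]subr0; apply: cint_bound => //; first by rewrite ltW ?pi2_gt0.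
by move=> t _ /=; apply: fK; rewrite nmM nm_cis mulr1 nmR ger0_norm.
Qed.

Lemma nm_mk (h : R * R) : nm (h.1 +i* h.2 : C) <= 1 * norm1 h.
Proof. by rewrite mul1r; exact: nm_ReIm. Qed.

Lemma diff_polar_comp (q : C -> C) p : cdiff q (polar p) ->
  exists D : C, diffat norm1 (q \o polar) p (fun h => D * (h.1 +i* h.2)).
Proof.
move=> [c hc].
have b1 (h : R * R) : nm ((h.1 +i* h.2) * polar p) <= nm (polar p) * norm1 h.
  by rewrite nmM mulrC ler_wpM2l ?nm_ge0 // -[norm1 h]mul1r nm_mk.
exists (c * polar p).
apply: (diffat_ext (r := 1) _ _ _ _ (diffat_comp norm1_ge0 b1 (@diff_polar p) hc)) => //.
  by rewrite /norm1 normr0 addr0.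
by move=> h; ring.
Qed.

Lemma max_lipschitz (a x y : R) : `|Num.max a x - Num.max a y| <= `|x - y|.
Proof.
wlog xy : x y / y <= x.
  by move=> W; case: (leP y x) => [/W //|/ltW/W]; rewrite distrC [X in _ <= X]distrC.
rewrite !ger0_norm ?subr_ge0 ?ge_max ?le_max ?lexx ?xy ?orbT //.
by case: (leP a x) => ?; case: (leP a y) => ?; lra.
Qed.

Lemma min_lipschitz (a x y : R) : `|Num.min x a - Num.min y a| <= `|x - y|.
Proof.
have H z : Num.min z a = - Num.max (- a) (- z) by rewrite -oppr_min opprK minC.
by rewrite !H opprK addrC (le_trans (max_lipschitz _ _ _)) // opprK addrC.
Qed.

(** Goursat's theorem for q(exp(s + it)) on [ln r1, ln r2] x [0, 2 pi]: by periodicity the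
two horizontal sides cancel, and the vertical ones are the two means. *)
Lemma cmean_annulus q r1 r2 : 0 < r1 -> r1 <= r2 ->
  (forall z, r1 <= nm z <= r2 -> cdiff q z) -> cmean q r1 = cmean q r2.
Proof.
move=> r10 r12 dq; have r20 := lt_le_trans r10 r12.
pose s1 := ln r1; pose a := ln r2 - ln r1.
have a0 : 0 <= a by rewrite subr_ge0 ler_ln.
have E1 : expR s1 = r1 by rewrite lnK.
have E2 : expR (s1 + a) = r2 by rewrite subrKC lnK.
have dq' p : s1 <= p.1 <= s1 + a -> cdiff q (polar p).
  by move=> /andP[p1 p2]; apply: dq; rewrite nm_polar -E1 -E2 !ler_expR p1.
(* Goursat's theorem needs slices continuous on the whole line, hence the clamping of s. *)
pose cl s := Num.max s1 (Num.min s (s1 + a)).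
have cl_in s : s1 <= cl s <= s1 + a.
  by rewrite le_max lexx /= ge_max lerDl a0 /= ge_min lexx orbT.
have cl_id s : s1 <= s <= s1 + a -> cl s = s.
  by move=> /andP[i1 i2]; rewrite /cl min_l // max_r.
have cl_lip s u : `|cl (s + u) - cl s| <= `|u|.
  have -> : `|u| = `|s + u - s| by rewrite addrAC subrr add0r.
  exact: le_trans (max_lipschitz _ _ _) (min_lipschitz _ _ _).
pose Q s t := q (polar (cl s, t)).
have pairD (x y x' y' : R) : (x, y) + (x', y') = (x + x', y + y') by [].
have dQ s t : exists D : C, diffat norm1 (q \o polar) (cl s, t) (fun h => D * (h.1 +i* h.2)).
  by apply: diff_polar_comp; apply: dq'; exact: cl_in.
have cQ0 s t e : 0 < e -> exists2 d : R, 0 < d &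
    forall h, norm1 h < d -> nm (q (polar ((cl s, t) + h)) - q (polar (cl s, t))) < e.
  have [D hD] := dQ s t; apply: (diffat_cont (K := nm D) norm1_ge0 _ hD).
  by move=> h; rewrite nmM ler_wpM2l ?nm_ge0 // -[norm1 h]mul1r nm_mk.
have cQ : separately_continuous Q.
  split=> [t s e /cQ0 - /(_ s t)|s t e /cQ0 - /(_ s t)] [d d0 hd]; exists d => // u ud.
    have := hd (cl (s + u) - cl s, 0); rewrite /norm1 /= normr0 addr0.
    move=> /(_ (le_lt_trans (cl_lip s u) ud)).
    by rewrite pairD subrKC addr0.
  have := hd (0, u); rewrite /norm1 /= normr0 add0r => /(_ ud).
  by rewrite pairD addr0.
have pi0 := pi2_gt0.
have := goursat (s := s1) (a := a) (t := 0) (b := pi *+ 2) cQ a0 (ltW pi0).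
have circ s t : s1 <= s <= s1 + a -> Q s t = (q \o circle (expR s)) t.
  by move=> hs; rewrite /Q cl_id.
have per s : Q s (0 + pi *+ 2) = Q s 0.
  by rewrite /Q /polar /cis /= add0r cos2pi sin2pi cos0 sin0.
have -> : boundary_int Q s1 a 0 (pi *+ 2) =
    'i * (cmean q r2 - cmean q r1) * (pi *+ 2)%:C.
  rewrite /boundary_int.
  have -> : Q^~ (0 + pi *+ 2) = Q^~ 0 by apply/funext => s; exact: per.
  have -> : Q (s1 + a) = q \o circle r2.
    by apply/funext => t; rewrite circ ?E2 // lexx lerDl a0.
  have -> : Q s1 = q \o circle r1.
    by apply/funext => t; rewrite circ ?E1 // lexx lerDl a0.
  rewrite !add0r /cmean mulrBr mulrBl -!mulrA !mulVf ?mulr1; first by ring.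
  by apply/eqP => -[/eqP]; rewrite gt_eqF.
move=> H; have {}H : 'i * (cmean q r2 - cmean q r1) * (pi *+ 2)%:C = 0.
  apply: H => x y xs yt; have [D hD] := dQ x y; exists D => e e0.
  have [d d0 hd] := hD e e0; exists (d / 2); first by lra.
  move=> x' y' xs' yt' xx yy.
  have := hd (x' - x, y' - y); rewrite /norm1 /= (cl_id _ xs) => /(_ ltac:(lra)).
  by rewrite pairD !subrKC /Q !cl_id.
apply/esym/eqP; rewrite -subr_eq0; apply/eqP/nm0_eq0.
move: H => /(congr1 (@nm _ _)); rewrite !nmM nmi mul1r nm0 nmR gtr0_norm //.
by move=> /eqP; rewrite mulf_eq0 (gt_eqF pi0) orbF => /eqP.
Qed.

End circle.

(** * Mean values and derivatives at the centre of a circle *)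

Section mean_value.
Context {R : realType}.
Local Notation C := R[i].
Local Notation dC := (diffat (D := C) (@nm R C)).
Local Notation dR := (diffat (D := R) (@Num.norm R R)).
Local Notation circle r := (fun t : R => r%:C * cis t).

Lemma cst_contR (k : C) : contR (fun _ : R => k).
Proof. by move=> t e e0; exists 1 => // u _; rewrite subrr nm0. Qed.

(** The mean does not depend on the radius, and on small circles q is close to l. *)
Lemma cmean_removable (q : C -> C) (r : R) (l : C) : 0 < r ->
  (forall z, 0 < nm z <= r -> cdiff q z) ->
  (forall e : R, 0 < e -> exists2 d : R, 0 < d &
     forall z, 0 < nm z < d -> nm (q z - l) <= e) ->
  cmean q r = l.
Proof.
move=> r0 dq ql; apply/eqP; rewrite -subr_eq0; apply/eqP/nm0_eq0.
apply/eqP; rewrite eq_le nm_ge0 andbT; apply/ler_addgt0Pr => e e0; rewrite add0r.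
have [d d0 hd] := ql e e0.
pose s := Num.min r (d / 2).
have s0 : 0 < s by rewrite lt_min r0 divr_gt0.
have sr : s <= r by rewrite ge_min lexx.
have sd : s < d by rewrite gt_min; apply/orP; right; lra.
rewrite -(cmean_annulus s0 sr); last first.
  by move=> z /andP[z1 z2]; apply: dq; rewrite z2 (lt_le_trans s0).
have cq : contR (q \o circle s).
  by apply: circle_contR => [|z zs]; [exact: ltW|apply: dq; rewrite zs s0].
have -> : cmean q s - l = cmean (fun z => 1 * q z + -1 * l) s.
  by rewrite cmean_lin ?cmean_cst //; [ring|exact: cst_contR].
apply: cmean_bound; [exact: ltW|by apply: contR_lin => //; exact: cst_contR|].
by move=> z zs; rewrite mul1r mulN1r; apply: hd; rewrite zs s0.
Qed.

Lemma cmean_value (q : C -> C) (r : R) : 0 < r ->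
  (forall z, nm z <= r -> cdiff q z) -> cmean q r = q 0.
Proof.
move=> r0 dq; apply: cmean_removable => //.
  by move=> z /andP[_]; exact: dq.
move=> e e0; have [c hc] : cdiff q 0 by apply: dq; rewrite nm0 ltW.
have [|d d0 hd] := diffat_cont (K := nm c) (@nm_ge0 _ _) _ hc e0.
  by move=> h; rewrite nmM.
by exists d => // z /andP[_ /hd]; rewrite add0r => /ltW.
Qed.

(** The mean on the circle of radius s is at most 1/s and does not depend on s. *)
Lemma cmean_inv (r : R) : 0 < r -> cmean (@GRing.inv C) r = 0.
Proof.
move=> r0; apply/nm0_eq0/eqP; rewrite eq_le nm_ge0 andbT.
apply/ler_addgt0Pr => e e0; rewrite add0r.
pose s := Num.max r e^-1.
have rs : r <= s by rewrite le_max lexx.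
have es : e^-1 <= s by rewrite le_max lexx orbT.
have s0 := lt_le_trans r0 rs.
have dinv z : 0 < nm z -> cdiff (@GRing.inv C) z.
  move=> z0; exists (- z ^- 2); apply: diff_inv.
  by apply/eqP => z1; rewrite z1 nm0 ltxx in z0.
rewrite (cmean_annulus r0 rs); last first.
  by move=> z /andP[z1 _]; apply: dinv; exact: lt_le_trans z1.
apply: cmean_bound; first exact: ltW.
  by apply: circle_contR => [|z zs]; [exact: ltW|apply: dinv; rewrite zs].
by move=> z zs; rewrite nmV zs -(invrK e) lef_pV2 // posrE invr_gt0.
Qed.

Lemma cdiff_div (f : C -> C) z : z != 0 -> cdiff f z -> cdiff (fun w => f w / w) z.
Proof.
by move=> z0 [c hc]; exists (c * z^-1 + f z * - z ^- 2); exact: dC_mul hc (diff_inv z0).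
Qed.

Lemma nm_neq0 (z : C) : 0 < nm z -> z != 0.
Proof. by move=> z0; apply/eqP => z1; rewrite z1 nm0 ltxx in z0. Qed.

(** Near 0 one has f(z)/z = f(0)/z + c + o(1), and the mean of 1/z is zero. *)
Lemma cmean_derivative (f : C -> C) (r : R) (c : C) : 0 < r ->
  (forall z, nm z <= r -> cdiff f z) -> dC f 0 ( *%R c) ->
  cmean (fun z => f z / z) r = c.
Proof.
move=> r0 df hc.
have dq z : 0 < nm z <= r -> cdiff (fun z => f z / z) z.
  by move=> /andP[/nm_neq0 z0 /df]; exact: cdiff_div.
have dinv z : 0 < nm z -> cdiff (@GRing.inv C) z.
  by move=> /nm_neq0 z0; exists (- z ^- 2); exact: diff_inv.
have cont (q : C -> C) : (forall z, 0 < nm z <= r -> cdiff q z) -> contR (q \o circle r).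
  by move=> h; apply: circle_contR; [exact: ltW|move=> z zr; apply: h; rewrite zr r0 lexx].
suff : cmean (fun z => 1 * (f z / z) + - f 0 * z^-1) r = c.
  rewrite cmean_lin ?cmean_inv //; first by rewrite mul1r mulr0 addr0.
    exact: cont dq.
  by apply: cont => z /andP[/dinv].
apply: cmean_removable => //.
  move=> z hz; have [a ha] := dq z hz; have [b hb] := dinv z (proj1 (andP hz)).
  by exists (1 * a + - f 0 * b); exact: dC_lin.
move=> e e0; have [d d0 hd] := hc e e0; exists d => // z /andP[z0 /hd].
rewrite add0r => i1; have z1 := nm_neq0 z0.
have -> : 1 * (f z / z) + - f 0 / z - c = (f z - f 0 - c * z) / z by field.
by rewrite nmM nmV ler_pdivrMr.
Qed.

End mean_value.

(** * Estimates for holomorphic functions of several variables *)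

Section several_variables.
Context {R : realType}.
Local Notation C := R[i].
Local Notation dC := (diffat (D := C) (@nm R C)).
Local Notation dR := (diffat (D := R) (@Num.norm R R)).
Local Notation circle r := (fun t : R => r%:C * cis t).

Section dimension.
Variable n : nat.
Local Notation V := 'rV[C]_n.
Implicit Types (g : V -> C) (z h d : V).

Definition dot h d : C := \sum_j h 0 j * d 0 j.

Definition gdiff g z d := diffat (@nm R V) g z (dot^~ d).

Lemma dotZ t h d : dot (t *: h) d = t * dot h d.
Proof. by rewrite /dot mulr_sumr; apply: eq_bigr => j _; rewrite mxE mulrA. Qed.

Lemma dotBr h d d' : dot h (d - d') = dot h d - dot h d'.
Proof. by rewrite /dot -sumrB; apply: eq_bigr => j _; rewrite !mxE mulrBr. Qed.

Lemma dot_delta j d : dot (delta_mx 0 j) d = d 0 j.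
Proof.
rewrite /dot (bigD1 j) //= mxE !eqxx mul1r big1 ?addr0 // => i ij.
by rewrite mxE (negbTE ij) andbF mul0r.
Qed.

Lemma nm_dot h d (K : R) : (forall j, nm (d 0 j) <= K) -> nm (dot h d) <= n%:R * K * nm h.
Proof.
move=> dK; rewrite (le_trans (nm_sum _ _ _)) //.
have -> : n%:R * K * nm h = \sum_(j < n) nm h * K.
  by rewrite sumr_const card_ord -mulr_natr; ring.
by apply: ler_sum => j _; rewrite nmM ler_pM ?nm_ge0 // nm_rV.
Qed.

Lemma nm_dot_self h d : nm (dot h d) <= n%:R * nm d * nm h.
Proof. by apply: nm_dot => j; exact: nm_rV. Qed.

Lemma nm_delta j : nm (delta_mx 0 j : V) <= 1.
Proof.
apply: nm_rV_le => // i; rewrite mxE eqxx /=.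
by case: (i == j); rewrite ?nm1 ?nm0.
Qed.

Lemma gdiff_line g z h t d : gdiff g (z + t *: h) d ->
  dC (fun u => g (z + u *: h)) t ( *%R (dot h d)).
Proof.
move=> dg.
have E u : z + (t + u) *: h = z + t *: h + u *: h by rewrite scalerDl addrA.
have B u : nm (u *: h) <= nm h * nm u by rewrite nmZ mulrC.
apply: (diffat_ext (r := 1) _ _ _ _ (@diffat_path _ _ _ (@nm R C) (@nm R V) g (dot^~ d)
  (fun u => z + u *: h) t (fun u => u *: h) (nm h) (@nm_ge0 _ _) E B dg)) => //.
  by rewrite nm0.
by move=> u; rewrite /= dotZ mulrC.
Qed.

Lemma gdiff_seg g z h (t : R) d : gdiff g (z + t%:C *: h) d ->
  dR (fun u => g (z + u%:C *: h)) t (fun u => u%:C * dot h d).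
Proof.
move=> dg.
have E (u : R) : z + (t + u)%:C *: h = z + t%:C *: h + u%:C *: h.
  by rewrite rmorphD scalerDl addrA.
have B (u : R) : nm (u%:C *: h) <= nm h * `|u| by rewrite nmZ nmR mulrC.
apply: (diffat_ext (r := 1) _ _ _ _ (@diffat_path _ _ _ (@Num.norm R R) (@nm R V) g
  (dot^~ d) (fun u => z + u%:C *: h) t (fun u => u%:C *: h) (nm h) (@normr_ge0 _ _)
  E B dg)) => //.
  by rewrite normr0.
by move=> u; rewrite /= dotZ.
Qed.

Lemma gdiff_unique g z d d' : gdiff g z d -> gdiff g z d' -> d = d'.
Proof.
move=> h1 h2; apply/rowP => j; rewrite -!(dot_delta j).
apply: (@dC_unique _ (fun u => g (z + u *: delta_mx 0 j)) 0);
  by apply: gdiff_line; rewrite scale0r addr0.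
Qed.

Definition grad g z : V :=
  if pselect (exists d, gdiff g z d) is left e then projT1 (cid e) else 0.

Lemma gradP g z : (exists d, gdiff g z d) -> gdiff g z (grad g z).
Proof. by move=> e; rewrite /grad; case: pselect => // e'; case: cid. Qed.

Lemma gradE g z d : gdiff g z d -> grad g z = d.
Proof. by move=> dg; apply: (gdiff_unique (gradP _) dg); exists d. Qed.

Definition pd (j : 'I_n) g z : C := grad g z 0 j.

Definition hol (U : set V) g := forall z, U z -> exists d, gdiff g z d.

(** [cmean_derivative] on the complex line through z in the j-th direction. *)
Lemma pd_cmean g z (j : 'I_n) (r : R) : 0 < r ->
  hol [set w | nm (w - z) <= r] g ->
  cmean (fun u => g (z + u *: delta_mx 0 j) / u) r = pd j g z.
Proof.
move=> r0 hg; rewrite /pd -(dot_delta j).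
apply: (cmean_derivative (f := fun u => g (z + u *: delta_mx 0 j))) => //.
  move=> u ur; have [|d hd] := hg (z + u *: delta_mx 0 j).
    rewrite /= addrAC subrr add0r nmZ (le_trans _ ur) //.
    by rewrite ler_piMr ?nm_ge0 // nm_delta.
  by exists (dot (delta_mx 0 j) d); exact: gdiff_line.
apply: gdiff_line; rewrite scale0r addr0; apply: gradP; apply: hg.
by rewrite /= subrr nm0 ltW.
Qed.

Lemma mvt_seg g z h (k : R -> C) (K : R) :
  (forall t, 0 <= t <= 1 -> dR (fun u => g (z + u%:C *: h)) t (fun u => u%:C * k t)) ->
  (forall t, 0 <= t <= 1 -> nm (k t) <= K) -> nm (g (z + h) - g z) <= K.
Proof.
move=> dg kK.
have := mvt_real (H := fun u => g (z + u%:C *: h)) ler01 dg kK.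
by rewrite subr0 mulr1 scale1r scale0r addr0.
Qed.

Lemma seg_ball z w h (r : R) t : 0 <= t <= 1 -> nm (z - w) < r -> nm (z + h - w) < r ->
  nm (z + t%:C *: h - w) < r.
Proof.
move=> /andP[t0 t1] h0 h1.
have -> : z + t%:C *: h - w = (1 - t)%:C *: (z - w) + t%:C *: (z + h - w).
  rewrite [z + h - w]addrAC [LHS]addrAC; move: (z - w) => a.
  by rewrite rmorphB scalerBl scale1r scalerDr addrA subrK.
rewrite (le_lt_trans (nmD _ _)) // !nmZ !nmR !ger0_norm ?subr_ge0 //.
move: t0; rewrite le_eqVlt => /orP[/eqP <-|t0]; first by lra.
by nra.
Qed.

Section ball_estimates.
Variables (g : V -> C) (p : V) (r K : R).
Hypothesis r0 : 0 < r.
Hypothesis hg : hol [set z | nm (z - p) < r] g.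
Hypothesis gK : forall z, nm (z - p) < r -> nm (g z) <= K.

Let K0 : 0 <= K.
Proof. by rewrite (le_trans (nm_ge0 _) (gK (z := p) _)) // subrr nm0. Qed.

Lemma ball_shift z w (s t : R) : nm (z - p) < s -> nm (w - z) <= t -> nm (w - p) < s + t.
Proof. by move=> zs wt; have := nm_tri z w p; lra. Qed.

Lemma nm_shift z h : nm (z + h - z) = nm h.
Proof. by rewrite addrAC subrr add0r. Qed.

Lemma nm_shift_delta z (u : C) (j : 'I_n) : nm (z + u *: delta_mx 0 j - z) <= nm u.
Proof. by rewrite nm_shift nmZ ler_piMr ?nm_ge0 // nm_delta. Qed.

Lemma quot_cont z (j : 'I_n) (s : R) : 0 < s -> nm (z - p) < r - s ->
  contR ((fun u => g (z + u *: delta_mx 0 j) / u) \o circle s).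
Proof.
have rp := r0.
move=> s0 zs; apply: circle_contR => [|u us]; first exact: ltW.
apply: (cdiff_div (f := fun u => g (z + u *: delta_mx 0 j))).
  by apply: nm_neq0; rewrite us.
have [|d hd] := hg (z := z + u *: delta_mx 0 j).
  have := ball_shift zs (nm_shift_delta z u j); rewrite us /=; lra.
by exists (dot (delta_mx 0 j) d); exact: gdiff_line.
Qed.

Lemma pd_circle z (j : 'I_n) (s : R) : 0 < s -> nm (z - p) < r - s ->
  cmean (fun u => g (z + u *: delta_mx 0 j) / u) s = pd j g z.
Proof.
move=> s0 zs; apply: pd_cmean => // w /= wz; apply: hg.
by have := ball_shift zs wz; rewrite subrK.
Qed.

(** Cauchy's estimate, on circles of radius r/4. *)
Lemma pd_bound z (j : 'I_n) : nm (z - p) < r / 2 -> nm (pd j g z) <= 4 * K / r.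
Proof.
have rp := r0; move=> zr; have zr' : nm (z - p) < r - r / 4 by lra.
have r4 : 0 < r / 4 by lra.
rewrite -(pd_circle j r4 zr'); apply: cmean_bound; first exact: ltW.
  exact: quot_cont.
move=> u ur; rewrite nmM nmV ur invf_div [4 * K]mulrC -mulrA.
apply: ler_wpM2r; first by rewrite divr_ge0 // ltW.
by apply: gK; have := ball_shift zr' (nm_shift_delta z u j); rewrite ur; lra.
Qed.

Let L := n%:R * (4 * K / r).
Let L0 : 0 <= L.
Proof. by rewrite !mulr_ge0 ?invr_ge0 // ltW. Qed.

Lemma g_lipschitz z w : nm (z - p) < r / 2 -> nm (w - p) < r / 2 ->
  nm (g z - g w) <= L * nm (z - w).
Proof.
have rp := r0.
move=> zr wr; rewrite -[z in g z](subrKC w).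
have inb t : 0 <= t <= 1 -> nm (w + t%:C *: (z - w) - p) < r / 2.
  by move=> t01; apply: seg_ball; rewrite ?subrKC.
apply: (mvt_seg (k := fun t => dot (z - w) (grad g (w + t%:C *: (z - w))))) => t t01.
  apply: gdiff_seg; apply: gradP; apply: hg.
  by have := inb t t01; rewrite /=; lra.
by apply: nm_dot => j; apply: pd_bound; exact: inb.
Qed.

Let L' := L / (r / 8).
Let L'0 : 0 <= L'.
Proof. by have rp := r0; rewrite divr_ge0 //; lra. Qed.

(** Two partial derivatives are means over the same circle of values of g at points which
differ by z - w, so the Lipschitz property passes from g to its derivatives. *)
Lemma pd_lipschitz (j : 'I_n) z w : nm (z - p) < r / 4 -> nm (w - p) < r / 4 ->
  nm (pd j g z - pd j g w) <= L' * nm (z - w).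
Proof.
have rp := r0.
move=> zr wr; have r8 : 0 < r / 8 by lra.
have zr' : nm (z - p) < r - r / 8 by lra.
have wr' : nm (w - p) < r - r / 8 by lra.
rewrite -(pd_circle j r8 zr') -(pd_circle j r8 wr').
have c1 := quot_cont j r8 zr'; have c2 := quot_cont j r8 wr'.
have := cmean_lin 1 (-1) c1 c2; rewrite mul1r mulN1r => <-.
apply: cmean_bound; [exact: ltW|exact: contR_lin|move=> u ur].
rewrite mul1r mulN1r -mulrBl nmM nmV ur mulrAC ler_wpM2r ?invr_ge0 ?(ltW r8) //.
have := g_lipschitz (z := z + u *: delta_mx 0 j) (w := w + u *: delta_mx 0 j).
rewrite opprD addrACA subrr addr0; apply.
  by have := ball_shift zr (nm_shift_delta z u j); rewrite ur; lra.
by have := ball_shift wr (nm_shift_delta w u j); rewrite ur; lra.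
Qed.

(** Apply the mean value inequality to g minus its linear part at w, whose gradient is
small near w because the gradient of g is Lipschitz. *)
Lemma g_strict (w z z' : V) (e : R) : nm (w - p) < r / 4 ->
  nm (z - p) < r / 4 -> nm (z' - p) < r / 4 ->
  nm (z - w) < e -> nm (z' - w) < e ->
  nm (g z - g z' - dot (z - z') (grad g w)) <= n%:R * (L' * e) * nm (z - z').
Proof.
have rp := r0.
move=> wr zr z'r ze z'e.
pose k y := g y - dot (y - z') (grad g w).
have -> : g z - g z' - dot (z - z') (grad g w) = k (z' + (z - z')) - k z'.
  rewrite /k subrKC subrr.
  have -> : dot 0 (grad g w) = 0 by rewrite -[0](scale0r 0) dotZ mul0r.
  by rewrite subr0 addrAC.
apply: (mvt_seg (k := fun t => dot (z - z') (grad g (z' + t%:C *: (z - z')) - grad g w))).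
  move=> t t01.
  have zt : nm (z' + t%:C *: (z - z') - p) < r / 4 by apply: seg_ball; rewrite ?subrKC.
  have d1 : dR (fun u => g (z' + u%:C *: (z - z'))) t
     (fun u => u%:C * dot (z - z') (grad g (z' + t%:C *: (z - z')))).
    by apply: gdiff_seg; apply: gradP; apply: hg; rewrite /=; lra.
  have d2 : dR (fun u => u%:C * dot (z - z') (grad g w)) t
     (fun u => u%:C * dot (z - z') (grad g w)).
    move=> a a0; exists 1 => // u _; rewrite rmorphD mulrDl [X in X - _ - _]addrC addrK subrr.
    by rewrite nm0 mulr_ge0 // ltW.
  apply: (diffat_ext (r := 1) _ _ _ _ (diffat_lin 1 (-1) (@normr_ge0 _ _) d1 d2)) => //.
  - by rewrite normr0.
  - by move=> u _; rewrite /k [z' + _ - z']addrAC subrr add0r dotZ; ring.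
  - by move=> u; rewrite dotBr; ring.
move=> t t01; apply: nm_dot => j; rewrite !mxE.
have zt : nm (z' + t%:C *: (z - z') - p) < r / 4 by apply: seg_ball; rewrite ?subrKC.
have ze' : nm (z' + t%:C *: (z - z') - w) < e by apply: seg_ball; rewrite ?subrKC.
rewrite (le_trans (pd_lipschitz j zt wr)) //.
by rewrite ler_wpM2l // ltW.
Qed.

End ball_estimates.
End dimension.
End several_variables.

(** * Partial derivatives are holomorphic *)

Section holomorphic_functions.
Context {R : realType}.
Local Notation C := R[i].
Local Notation circle r := (fun t : R => r%:C * cis t).

Lemma cdiff_id (z : C) : cdiff id z.
Proof. by exists 1; exact: dC_id. Qed.

Lemma contR_mul (h k : R -> C) : contR h -> contR k -> contR (fun t => h t * k t).
Proof.
move=> hc kc t e e0; have [a0 b0] := (nm_ge0 (h t), nm_ge0 (k t)).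
pose e' := Num.min 1 (e / (nm (h t) + nm (k t) + 1)).
have B : 0 < nm (h t) + nm (k t) + 1 by lra.
have e'0 : 0 < e' by rewrite lt_min ltr01 divr_gt0.
have e'1 : e' <= 1 by rewrite ge_min lexx.
have e'e : e' * (nm (h t) + nm (k t) + 1) <= e.
  by rewrite -ler_pdivlMr // ge_min lexx orbT.
have [d d0 hd] := hc t e' e'0; have [d' d'0 hd'] := kc t e' e'0.
exists (Num.min d d') => [|u]; first by rewrite lt_min d0.
rewrite lt_min => /andP[/hd h1 /hd' h2].
set x := h (t + u) - h t in h1; set y := k (t + u) - k t in h2.
have -> : h (t + u) * k (t + u) - h t * k t = x * k t + h t * y + x * y.
  by rewrite /x /y; ring.
have := nmD (x * k t + h t * y) (x * y); have := nmD (x * k t) (h t * y).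
by rewrite !nmM; have := nm_ge0 x; have := nm_ge0 y; nra.
Qed.

Lemma contR_sum (I : Type) (s : seq I) (x : I -> C) (h : I -> R -> C) :
  (forall i, contR (h i)) -> contR (fun t => \sum_(i <- s) x i * h i t).
Proof.
move=> hc; elim: s => [|i s IH].
  have -> : (fun t => \sum_(i <- [::]) x i * h i t) = fun=> 0.
    by apply/funext => t; rewrite big_nil.
  exact: cst_contR.
have -> : (fun t => \sum_(i0 <- i :: s) x i0 * h i0 t) =
    fun t => x i * h i t + 1 * \sum_(i <- s) x i * h i t.
  by apply/funext => t; rewrite big_cons mul1r.
exact: contR_lin.
Qed.

Lemma cmean_sum (I : Type) (s : seq I) (x : I -> C) (q : I -> C -> C) (r : R) :
  (forall i, contR (q i \o circle r)) ->
  cmean (fun z => \sum_(i <- s) x i * q i z) r = \sum_(i <- s) x i * cmean (q i) r.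
Proof.
move=> hc; elim: s => [|i s IH].
  have -> : (fun z => \sum_(i <- [::]) x i * q i z) = fun=> 0.
    by apply/funext => t; rewrite big_nil.
  by rewrite cmean_cst big_nil.
have -> : (fun z => \sum_(i0 <- i :: s) x i0 * q i0 z) =
    fun z => x i * q i z + 1 * \sum_(i <- s) x i * q i z.
  by apply/funext => t; rewrite big_cons mul1r.
rewrite cmean_lin ?big_cons ?IH ?mul1r //.
exact: (contR_sum s x (h := fun i => q i \o circle r)).
Qed.

Section dimension.
Variable n : nat.
Local Notation V := 'rV[C]_n.
Implicit Types (g : V -> C) (U : set V).

(** The formula for the i-th partial derivative as a mean can be differentiated under the
mean, since the second-order remainder of g is uniform on the circle; the gradient
is therefore the mean of the gradients of g divided by u. *)
Lemma pd_gdiff g (p : V) (r K : R) (i : 'I_n) : 0 < r ->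
  hol [set z | nm (z - p) < r] g ->
  (forall z, nm (z - p) < r -> nm (g z) <= K) ->
  exists d, gdiff (pd i g) p d.
Proof.
move=> r0 hg gK.
(* With this radius p + h + u e_i stays in the ball of radius r/4 of [g_strict]. *)
pose s := r / 16; have s0 : 0 < s by rewrite /s; lra.
have pp : nm (p - p) = 0 by rewrite subrr nm0.
pose L' := n%:R * (4 * K / r) / (r / 8).
have K0 : 0 <= K by rewrite (le_trans (nm_ge0 _) (gK p _)) // pp.
have L'0 : 0 <= L' by rewrite /L' !mulr_ge0 ?invr_ge0 //; lra.
have inb (z : V) u : nm (z - p) < s -> nm u = s -> nm (z + u *: delta_mx 0 i - p) < r / 4.
  move=> zs us; have := nm_tri z (z + u *: delta_mx 0 i) p.
  by have := nm_shift_delta z u i; rewrite us /s in zs *; lra.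
have cj j : contR ((fun u => pd j g (p + u *: delta_mx 0 i) / u) \o circle s).
  apply: (@contR_mul (fun t => pd j g (p + (s%:C * cis t) *: delta_mx 0 i))
     (fun t => (s%:C * cis t)^-1)).
    move=> t e e0.
    have [d d0 hd] := @circle_contR _ id s (ltW s0) (fun z _ => cdiff_id z)
      t (e / (L' + 1)) ltac:(rewrite divr_gt0 //; lra).
    exists d => // u /hd /=; rewrite ltr_pdivlMr; last lra.
    move=> h1; have ns v : nm (s%:C * cis v : C) = s.
      by rewrite nmM nm_cis mulr1 nmR gtr0_norm.
    have b0 v := inb p _ (eq_ind_r (fun x => x < s) s0 pp) (ns v).
    apply: le_lt_trans (pd_lipschitz r0 hg gK j (b0 _) (b0 _)) _.
    rewrite opprD addrACA subrr add0r -scalerBl nmZ.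
    have := nm_delta (R := R) i; set m := nm (delta_mx 0 i); set k := nm _ in h1 *.
    have m0 : 0 <= m := nm_ge0 _; have k0 : 0 <= k := nm_ge0 _.
    move=> m1; have : k * m <= k by rewrite ler_piMr.
    by rewrite -/L'; nra.
  apply: (@circle_contR _ (@GRing.inv C)) => [|u us]; first exact: ltW.
  by exists (- u ^- 2); apply: diff_inv; apply: nm_neq0; rewrite us.
exists (\row_j cmean (fun u => pd j g (p + u *: delta_mx 0 i) / u) s).
move=> e e0.
pose A := n%:R * (L' * 2) / s.
have A0 : 0 <= A by rewrite /A divr_ge0 ?(ltW s0) // mulr_ge0 // mulr_ge0.
exists (Num.min s (e / (A + 1))) => [|h].
  by rewrite lt_min s0 divr_gt0 //; lra.
rewrite lt_min => /andP[hs he0].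
have he : nm h * (A + 1) < e by rewrite -ltr_pdivlMr //; lra.
have ph : nm (p + h - p) < s by rewrite nm_shift.
have [b1 b2] : nm (p + h - p) < r - s /\ nm (p - p) < r - s.
  by rewrite pp; move: ph; rewrite /s; lra.
rewrite -(pd_circle hg i s0 b1) -(pd_circle hg i s0 b2).
have -> : dot h (\row_j cmean (fun u => pd j g (p + u *: delta_mx 0 i) / u) s) =
    cmean (fun u => \sum_j h 0 j * (pd j g (p + u *: delta_mx 0 i) / u)) s.
  by rewrite cmean_sum //; apply: eq_bigr => j _; rewrite !mxE.
have c1 := quot_cont r0 hg i s0 b1; have c2 := quot_cont r0 hg i s0 b2.
have c3 : contR ((fun u => \sum_j h 0 j * (pd j g (p + u *: delta_mx 0 i) / u)) \o circle s).
  exact: (contR_sum (index_enum _) (fun j => h 0 j) cj).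
have c12 := contR_lin 1 (-1) c1 c2.
have := cmean_lin 1 (-1) c1 c2; rewrite mul1r mulN1r => <-.
rewrite -[cmean (fun z => 1 * _ + _) s]mul1r -[- cmean _ s]mulN1r -cmean_lin //.
have bnd : n%:R * (L' * (2 * nm h)) * nm h / s <= e * nm h.
  have -> : n%:R * (L' * (2 * nm h)) * nm h / s = A * nm h * nm h.
    by rewrite /A; field; apply: lt0r_neq0.
  by rewrite ler_wpM2r ?nm_ge0 //; have := nm_ge0 h; nra.
apply: (le_trans _ bnd); apply: cmean_bound; [exact: ltW|exact: contR_lin|].
move=> u us; have u0 : u != 0 by apply: nm_neq0; rewrite us.
set w := p + u *: delta_mx 0 i.
have -> : 1 * (1 * (g (p + h + u *: delta_mx 0 i) / u) + -1 * (g w / u)) +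
   -1 * \sum_j h 0 j * (pd j g w / u) = (g (w + h) - g w - dot h (grad g w)) / u.
  have -> : \sum_j h 0 j * (pd j g w / u) = dot h (grad g w) / u.
    by rewrite mulr_suml; apply: eq_bigr => j _; rewrite mulrA.
  by rewrite addrAC -/w; ring.
rewrite nmM nmV us ler_wpM2r ?invr_ge0 ?(ltW s0) //.
have wr : nm (w - p) < r / 4 by apply: inb; rewrite ?pp.
have whr : nm (w + h - p) < r / 4 by rewrite /w [_ + _ + h]addrAC; apply: inb.
have [h0|hn0] := eqVneq h 0.
  rewrite h0 addr0 subrr nm0 mulr0 sub0r nmN (_ : dot 0 _ = 0) ?nm0 //.
  by rewrite -[0](scale0r 0) dotZ mul0r.
have hgt := nm_gt0 hn0.
have := g_strict r0 hg gK (e := 2 * nm h) wr whr wr.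
have -> : w + h - w = h by rewrite addrAC subrr add0r.
by rewrite subrr nm0; apply; lra.
Qed.

Lemma open_ball_nm U p : open U -> U p -> exists2 r : R, 0 < r &
  forall z, nm (z - p) < r -> U z.
Proof.
move=> oU Up; apply/nbhs_nmP; exact: open_nbhs_nbhs.
Qed.

(** The estimates on balls need a bound for g, which continuity provides locally. *)
Lemma hol_bounded U g p : open U -> hol U g -> U p ->
  exists r K, [/\ 0 < r, hol [set z | nm (z - p) < r] g &
    forall z, nm (z - p) < r -> U z /\ nm (g z) <= K].
Proof.
move=> oU hg Up; have [r r0 hr] := open_ball_nm oU Up.
have [d hd] := hg p Up.
have [|s s0 hs] := diffat_cont (K := n%:R * nm d) (@nm_ge0 _ _) _ hd ltr01.
  by move=> h; exact: nm_dot_self.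
exists (Num.min r s), (nm (g p) + 1); split.
- by rewrite lt_min r0.
- by move=> z /=; rewrite lt_min => /andP[/hr Uz _]; exact: hg.
- move=> z; rewrite lt_min => /andP[/hr Uz /hs]; rewrite subrKC => h1.
  split=> //; have := nmD (g z - g p) (g p); rewrite subrK; lra.
Qed.

Lemma hol_pd U g i : open U -> hol U g -> hol U (pd i g).
Proof.
move=> oU hg p Up; have [r [K [r0 hr gK]]] := hol_bounded oU hg Up.
by apply: (pd_gdiff (K := K) i r0 hr) => z /gK[].
Qed.

(** Strict differentiability: the increments of g between any two points near p, not only
those from p, are given by the differential at p up to a small factor. *)
Lemma hol_strict U g p : open U -> hol U g -> U p -> exists r A,
  [/\ 0 < r, 0 <= A, forall z, nm (z - p) < r -> U z &
  forall e z z', e <= r -> nm (z - p) < e -> nm (z' - p) < e ->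
    nm (g z - g z' - dot (z - z') (grad g p)) <= A * e * nm (z - z')].
Proof.
move=> oU hg Up; have [r [K [r0 hr gK]]] := hol_bounded oU hg Up.
have gK' z : nm (z - p) < r -> nm (g z) <= K by move=> /gK[].
have K0 : 0 <= K by rewrite (le_trans (nm_ge0 _) (gK' p _)) // subrr nm0.
exists (r / 4), (n%:R * (n%:R * (4 * K / r) / (r / 8))); split.
- by lra.
- have [a1 a2] : 0 <= 4 * K / r /\ 0 <= r / 8 by split; [apply: divr_ge0|]; lra.
  by rewrite mulr_ge0 // divr_ge0 // mulr_ge0.
- by move=> z zr; have [] := gK z ltac:(lra).
move=> e z z' er ze z'e; rewrite -[_ * _ * e]mulrA.
by apply: (g_strict r0 hr gK') => //; rewrite ?subrr ?nm0; lra.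
Qed.

Lemma hol_cont U g p : open U -> hol U g -> U p -> forall e : R, 0 < e ->
  exists2 d : R, 0 < d & forall z, nm (z - p) < d -> nm (g z - g p) < e.
Proof.
move=> oU hg Up e e0; have [d hd] := hg p Up.
have [|s s0 hs] := diffat_cont (K := n%:R * nm d) (@nm_ge0 _ _) _ hd e0.
  by move=> h; exact: nm_dot_self.
by exists s => // z /hs; rewrite subrKC.
Qed.

End dimension.
End holomorphic_functions.

(** * The identity principle *)

Section identity.
Context {R : realType}.
Local Notation C := R[i].
Local Notation dC := (diffat (D := C) (@nm R C)).
Local Notation circle r := (fun t : R => r%:C * cis t).

Lemma cdiff_mul (f g : C -> C) z : cdiff f z -> cdiff g z -> cdiff (fun w => f w * g w) z.
Proof. by move=> [c hc] [d hd]; exists (c * g z + f z * d); exact: dC_mul. Qed.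

Lemma cdiff_invX k (z : C) : z != 0 -> cdiff (fun w => w ^- k) z.
Proof.
move=> z0; elim: k => [|k IH]; first by exists 0; exact: dC_cst.
have -> : (fun w : C => w ^- k.+1) = fun w => w^-1 * w ^- k.
  by apply/funext => w; rewrite exprS invfM.
by apply: cdiff_mul IH; exists (- z ^- 2); exact: diff_inv.
Qed.

(** If f vanishes to infinite order at 0, the function f(z)/z^k is holomorphic also at 0.
Its value at 1 is its mean on the circle of centre 1 and radius 3, where |z| >= 2;
so |f(1)| <= K / 2^k for all k. *)
Lemma flat_zero (f : C -> C) (K : R) :
  (forall z, nm z <= 4 -> cdiff f z /\ nm (f z) <= K) ->
  (forall k, exists A d, 0 < d /\ forall z, nm z < d -> nm (f z) <= A * nm z ^+ k) ->
  f 1 = 0.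
Proof.
move=> hf flat.
have f0 : f 0 = 0.
  have [A [d [d0 /(_ 0)]]] := flat 1%N; rewrite nm0 expr0n mulr0 => /(_ d0) h.
  by apply: nm0_eq0; apply/eqP; rewrite eq_le h nm_ge0.
suff H k : nm (f 1) <= K * 2^-1 ^+ k.
  apply: nm0_eq0; apply/eqP; rewrite eq_le nm_ge0 andbT leNgt; apply/negP => f1.
  have [k] := @half_pow_lt R K _ f1; by rewrite ltNge H.
(* As f(0) = 0, q(0) = 0 whatever the value given to the inverse of 0. *)
pose q z := f z * z ^- k.
have dq z : nm z <= 4 -> cdiff q z.
  move=> z4; have [z0|z0] := eqVneq z 0; last first.
    by apply: cdiff_mul; [case: (hf z z4)|exact: cdiff_invX].
  exists 0; rewrite z0 => e e0.
  have [A [d [d0 hd]]] := flat k.+2.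
  have [A0|A0] := leP A 0.
    exists d => // h hh; rewrite add0r mul0r subr0 /q f0 mul0r subr0 nmM.
    have -> : nm (f h) = 0.
      apply/eqP; rewrite eq_le nm_ge0 andbT (le_trans (hd h hh)) //.
      by rewrite mulr_le0_ge0 // exprn_ge0 // nm_ge0.
    by rewrite mul0r mulr_ge0 ?nm_ge0 // ltW.
  exists (Num.min d (e / A)) => [|h]; first by rewrite lt_min d0 divr_gt0.
  rewrite lt_min ltr_pdivlMr // => /andP[hh he].
  rewrite add0r mul0r subr0 /q f0 mul0r subr0.
  have [->|h0] := eqVneq h 0; first by rewrite f0 mul0r nm0 mulr0.
  have hgt := nm_gt0 h0.
  rewrite nmM nmV nmX ler_pdivrMr ?exprn_gt0 // (le_trans (hd h hh)) //.
  have -> : A * nm h ^+ k.+2 = A * nm h * (nm h * nm h ^+ k) by rewrite !exprS; ring.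
  by rewrite -[e * _ * _]mulrA ler_wpM2r ?mulr_ge0 ?exprn_ge0 ?nm_ge0 // mulrC ltW.
have q1 : f 1 = q (1 + 0) by rewrite addr0 /q expr1n invr1 mulr1.
have dq1 z : nm z <= 3 -> cdiff (fun u => q (1 + u)) z.
  move=> z3; have [|c hc] := dq (1 + z).
    by have := nmD 1 z; rewrite nm1; lra.
  exists c => e /hc[d d0 hd]; exists d => // h /hd.
  by rewrite addrA.
have r3 : 0 < 3 :> R by [].
rewrite q1 -(cmean_value (q := fun u => q (1 + u)) r3 dq1).
apply: cmean_bound => //.
  by apply: circle_contR => // z z3; apply: dq1; rewrite z3.
move=> z z3; have z2 : 2 <= nm (1 + z).
  by have := nmB (1 + z) 1; rewrite addrAC subrr add0r nm1 z3; lra.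
have z4 : nm (1 + z) <= 4 by have := nmD 1 z; rewrite nm1; lra.
rewrite nmM nmV nmX -exprVn; apply: ler_pM; rewrite ?nm_ge0 ?exprn_ge0 ?invr_ge0 ?nm_ge0 //.
  by case: (hf _ z4).
apply: lerXn2r; rewrite ?nnegrE ?invr_ge0 ?nm_ge0 //.
by rewrite lef_pV2 // posrE; lra.
Qed.

Section dimension.
Variable n : nat.
Local Notation V := 'rV[C]_n.
Implicit Types (g : V -> C) (U : set V).

Definition iterpd (s : seq 'I_n) g := foldr (fun j g => pd j g) g s.

Lemma hol_iterpd U g s : open U -> hol U g -> hol U (iterpd s g).
Proof. by move=> oU hg; elim: s => //= j s; exact: hol_pd. Qed.

Lemma iterpd_rcons s j g : iterpd (rcons s j) g = iterpd s (pd j g).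
Proof. by rewrite /iterpd foldr_rcons. Qed.

Lemma uniform_bound (p : V) (F : 'I_n -> V -> R) (G : V -> R) : (forall z, 0 <= G z) ->
  (forall j, exists A d, 0 < d /\ forall z, nm (z - p) < d -> F j z <= A * G z) ->
  exists A d, [/\ 0 <= A, 0 < d & forall j z, nm (z - p) < d -> F j z <= A * G z].
Proof.
move=> G0 /choice[A] /choice[d hd].
exists (\big[Num.max/0]_j A j), (\big[Num.min/1]_j d j); split.
- by rewrite bigmax_idl le_max lexx.
- by apply/bigmin_gtP; split=> // j _; case: (hd j).
move=> j z; move=> /bigmin_gtP[_ /(_ j isT) zd].
have [_ /(_ z zd)] := hd j; move=> /le_trans; apply.
by rewrite ler_wpM2r // le_bigmax.
Qed.

(** Induction on k: the partial derivatives vanish to order k, and the mean value inequality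
gains one power of the distance. *)
Lemma vanishing_order U p k : open U -> U p -> forall g, hol U g ->
  (forall s, (size s <= k)%N -> iterpd s g p = 0) ->
  exists A d, 0 < d /\ forall z, nm (z - p) < d -> nm (g z) <= A * nm (z - p) ^+ k.+1.
Proof.
move=> oU Up; elim: k => [|k IH] g hg gs; have g0 := gs [::] isT; rewrite /= in g0;
  have [r [A [r0 A0 rU hr]]] := hol_strict oU hg Up.
  exists (A * r + n%:R * nm (grad g p)), r; split=> // z zr.
  have := hr r z p (lexx _) zr; rewrite subrr nm0 g0 subr0 => /(_ r0) h1.
  have := nmD (g z - dot (z - p) (grad g p)) (dot (z - p) (grad g p)).
  rewrite subrK expr1 mulrDl => /le_trans; apply; apply: lerD => //.
  exact: nm_dot_self.
have [||B [d [B0 d0 hd]]] := @uniform_bound p (fun j z => nm (pd j g z))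
    (fun z => nm (z - p) ^+ k.+1).
- by move=> z; rewrite exprn_ge0 // nm_ge0.
- move=> j; apply: IH; first exact: hol_pd.
  by move=> s sk; rewrite -iterpd_rcons; apply: gs; rewrite size_rcons.
exists (n%:R * B), (Num.min r d); split=> [|z]; first by rewrite lt_min r0.
rewrite lt_min => /andP[zr zd].
have inb t (s : R) : 0 < s -> 0 <= t <= 1 -> nm (z - p) < s -> nm (p + t%:C *: (z - p) - p) < s.
  by move=> s0 t01 zs; apply: seg_ball; rewrite ?subrKC // subrr nm0.
have -> : g z = g (p + (z - p)) - g p by rewrite subrKC g0 subr0.
have -> : n%:R * B * nm (z - p) ^+ k.+2 = n%:R * (B * nm (z - p) ^+ k.+1) * nm (z - p).
  by rewrite [_ ^+ k.+2]exprSr; ring.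
apply: (mvt_seg (k := fun t => dot (z - p) (grad g (p + t%:C *: (z - p))))) => t t01.
  by apply: gdiff_seg; apply: gradP; apply: hg; apply: rU; exact: inb.
apply: nm_dot => j; rewrite (le_trans (hd j _ _)) //; first exact: inb.
rewrite ler_wpM2l // lerXn2r ?nnegrE ?nm_ge0 //.
rewrite nm_shift nmZ nmR; case/andP: t01 => t0 t1.
by rewrite ger0_norm // ler_piMl // nm_ge0.
Qed.

(** The identity principle, by restriction to complex lines through p: if z is close enough
to p, the function g(p + t (z - p)) is defined for |t| <= 4 and [flat_zero] applies. *)
Lemma hol_flat U g p : open U -> hol U g -> U p -> (forall s, iterpd s g p = 0) ->
  exists2 r : R, 0 < r & forall z, nm (z - p) < r -> U z /\ g z = 0.
Proof.
move=> oU hg Up gs; have [r [K [r0 hr gK]]] := hol_bounded oU hg Up.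
exists (r / 8) => [|z zr]; first by rewrite divr_gt0.
split; first by case: (gK z ltac:(lra)).
pose h := z - p; have -> : g z = g (p + 1 *: h) by rewrite scale1r subrKC.
have inb t : nm t <= 4 -> nm (p + t *: h - p) < r.
  by move=> t4; rewrite nm_shift nmZ /h; have := nm_ge0 (z - p); nra.
apply: (@flat_zero (fun t => g (p + t *: h)) K).
  move=> t /inb tr; split; last by case: (gK _ tr).
  by have [d hd] := hr _ tr; exists (dot h d); exact: gdiff_line.
move=> k; have [|A [d [d0 hd]]] := @vanishing_order U p k oU Up g hg; first by [].
have h0 : 0 < nm h + 1 by have := nm_ge0 h; lra.
exists (`|A| * nm h ^+ k.+1), (Num.min 1 (d / (nm h + 1))).
split; first by rewrite lt_min ltr01 divr_gt0.
move=> t; rewrite lt_min ltr_pdivlMr // => /andP[t1 td].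
have tn := nm_ge0 t; have := hd (p + t *: h); rewrite nm_shift nmZ.
move=> /(_ ltac:(nra))/le_trans; apply.
have x0 : 0 <= (nm t * nm h) ^+ k.+1 by rewrite exprn_ge0 // mulr_ge0 ?nm_ge0.
rewrite (le_trans (ler_wpM2r x0 (ler_norm A))) // -mulrA ler_wpM2l //.
rewrite exprMn mulrC ler_wpM2l ?exprn_ge0 ?nm_ge0 // exprS.
by rewrite ler_piMl ?exprn_ge0 // ltW.
Qed.

Lemma gdiff_cst (c : C) (z : V) : gdiff (fun=> c) z 0.
Proof.
move=> e e0; exists 1 => // h _.
rewrite subrr sub0r nmN (_ : dot h 0 = 0) ?nm0 ?mulr_ge0 ?nm_ge0 ?ltW //.
by rewrite /dot big1 // => j _; rewrite mxE mulr0.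
Qed.

Lemma hol_cst U (c : C) : hol U (fun=> c : C).
Proof. by move=> z _; exists 0; exact: gdiff_cst. Qed.

Lemma hol_lin U (a b : C) g g' : hol U g -> hol U g' -> hol U (fun z => a * g z + b * g' z).
Proof.
move=> hg hg' z Uz; have [d hd] := hg z Uz; have [d' hd'] := hg' z Uz.
exists (a *: d + b *: d').
apply: (diffat_ext (r := 1) _ _ _ _ (diffat_lin a b (@nm_ge0 _ _) hd hd')) => //.
  by rewrite nm0.
move=> h; rewrite /dot !mulr_sumr -big_split; apply: eq_bigr => j _ /=.
by rewrite !mxE; ring.
Qed.

Lemma hol_mul U g g' : hol U g -> hol U g' -> hol U (fun z => g z * g' z).
Proof.
move=> hg hg' z Uz; have [d hd] := hg z Uz; have [d' hd'] := hg' z Uz.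
exists (g' z *: d + g z *: d').
have b1 h : nm (dot h d) <= (n%:R * nm d + n%:R * nm d') * nm h.
  rewrite (le_trans (nm_dot_self _ _)) // ler_wpM2r ?nm_ge0 // lerDl.
  by rewrite mulr_ge0 // nm_ge0.
have b2 h : nm (dot h d') <= (n%:R * nm d + n%:R * nm d') * nm h.
  rewrite (le_trans (nm_dot_self _ _)) // ler_wpM2r ?nm_ge0 // lerDr.
  by rewrite mulr_ge0 // nm_ge0.
apply: (diffat_ext (r := 1) _ _ _ _ (diffat_mul (@nm_ge0 _ _) b1 b2 hd hd')) => //.
  by rewrite nm0.
move=> h; rewrite /dot mulr_suml mulr_sumr -big_split; apply: eq_bigr => j _ /=.
by rewrite !mxE; ring.
Qed.

Lemma hol_sum U (I : Type) (s : seq I) (F : I -> V -> C) :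
  (forall i, hol U (F i)) -> hol U (fun z => \sum_(i <- s) F i z).
Proof.
move=> hF; elim: s => [|i s IH].
  by under [X in hol U X]funext do rewrite big_nil; exact: hol_cst.
under [X in hol U X]funext do rewrite big_cons -[F i _]mul1r -[\sum_(_ <- _) _]mul1r.
exact: hol_lin.
Qed.

Lemma hol_prod U (I : Type) (s : seq I) (F : I -> V -> C) :
  (forall i, hol U (F i)) -> hol U (fun z => \prod_(i <- s) F i z).
Proof.
move=> hF; elim: s => [|i s IH].
  by under [X in hol U X]funext do rewrite big_nil; exact: hol_cst.
under [X in hol U X]funext do rewrite big_cons.
exact: hol_mul.
Qed.

Lemma hol_det U m (A : V -> 'M[C]_m) : (forall i j, hol U (fun z => A z i j)) ->
  hol U (fun z => \det (A z)).
Proof.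
move=> hA; rewrite /determinant; apply: hol_sum => s.
apply: hol_mul; first exact: hol_cst.
exact: hol_prod.
Qed.


End dimension.
End identity.

(** * Openness of holomorphic maps at regular points *)

Section holomorphic_maps.
Context {R : realType} (n : nat).
Local Notation C := R[i].
Local Notation V := 'rV[C]_n.
Implicit Types (F : V -> V) (U : set V).

Definition holmap U F := forall i, hol U (fun z => F z 0 i).

(** The transpose of the usual Jacobian matrix, as vectors are rows. *)
Definition jac F (z : V) : 'M[C]_n := \matrix_(j, i) pd j (fun w => F w 0 i) z.

Lemma mul_jac F z h i : (h *m jac F z) 0 i = dot h (grad (fun w => F w 0 i) z).
Proof. by rewrite mxE; apply: eq_bigr => j _; rewrite mxE. Qed.

Lemma mulmx_bounded (A : 'M[C]_n) : exists2 B : R, 0 < B &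
  forall h : V, nm (h *m A) <= B * nm h.
Proof.
pose K := \sum_(ij : 'I_n * 'I_n) nm (A ij.1 ij.2).
have K0 : 0 <= K by apply: sumr_ge0 => ij _; exact: nm_ge0.
exists (n%:R * K + 1); first by rewrite ltr_wpDl // mulr_ge0.
move=> h; apply: nm_rV_le => [|i].
  by rewrite mulr_ge0 ?nm_ge0 // addr_ge0 // mulr_ge0.
have -> : (h *m A) 0 i = dot h (\row_j A j i).
  by rewrite mxE; apply: eq_bigr => j _; rewrite mxE.
apply: le_trans (nm_dot (K := K) _ _) _ => [j|].
  rewrite mxE /K (bigD1 (j, i)) //= lerDl.
  by apply: sumr_ge0 => ij _; exact: nm_ge0.
by rewrite ler_wpM2r ?nm_ge0 // lerDl.
Qed.

Lemma holmap_strict U F p : open U -> holmap U F -> U p -> exists r A,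
  [/\ 0 < r, 0 <= A, forall z, nm (z - p) < r -> U z &
  forall e z z', e <= r -> nm (z - p) < e -> nm (z' - p) < e ->
    nm (F z - F z' - (z - z') *m jac F p) <= A * e * nm (z - z')].
Proof.
move=> oU hF Up.
have /choice[r /choice[A hA]] := fun i => hol_strict oU (hF i) Up.
have [r0 r00 rU] := open_ball_nm oU Up.
exists (\big[Num.min/r0]_i r i), (\big[Num.max/0]_i A i); split.
- by apply/bigmin_gtP; split=> // i _; case: (hA i).
- by rewrite bigmax_idl le_max lexx.
- by move=> z /bigmin_gtP[/rU].
move=> e z z' er ze z'e.
have e0 : 0 <= e by rewrite ltW // (le_lt_trans _ ze) // nm_ge0.
apply: nm_rV_le => [|i].
  by rewrite !mulr_ge0 ?nm_ge0 // bigmax_idl le_max lexx.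
have [_ _ _ /(_ e z z')] := hA i.
have -> : (F z - F z' - (z - z') *m jac F p) 0 i =
    F z 0 i - F z' 0 i - dot (z - z') (grad (fun w => F w 0 i) p).
  by rewrite -mul_jac !mxE.
move=> H; rewrite (le_trans (H _ ze z'e)) //.
  by apply: le_trans er _; apply: bigmin_le.
by rewrite ler_wpM2r ?nm_ge0 // ler_wpM2r // le_bigmax.
Qed.

(** Newton's iteration x + (y - F x) (dF_p)^-1 with the differential frozen at p: by
strict differentiability its steps decrease geometrically, with ratio 1/2. *)
Lemma holmap_open U F p (e0 : R) : open U -> holmap U F -> U p -> \det (jac F p) != 0 ->
  0 < e0 -> exists2 d : R, 0 < d &
  forall y, nm (y - F p) < d -> exists x, nm (x - p) < e0 /\ F x = y.
Proof.
move=> oU hF Up detF e00.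
have Junit : jac F p \in unitmx by rewrite unitmxE unitfE.
have [r [A [r0 A0 rU hr]]] := holmap_strict oU hF Up.
have [B B0 hB] := mulmx_bounded (invmx (jac F p)).
have [B' B'0 hB'] := mulmx_bounded (jac F p).
set J := jac F p in Junit hr hB hB'.
(* On the ball of radius e the iteration contracts by B A e <= 1/2. *)
pose e := Num.min (Num.min r e0) (2^-1 / (B * A + 1)).
have BA : 0 <= B * A by rewrite mulr_ge0 // ltW.
have e_gt0 : 0 < e by rewrite !lt_min r0 e00 divr_gt0 //; lra.
have [er ee0] : e <= r /\ e <= e0 by rewrite /e !ge_min !lexx !orbT.
have eBA : B * (A * e) <= 2^-1.
  have : e <= 2^-1 / (B * A + 1) by rewrite ge_min lexx orbT.
  by rewrite ler_pdivlMr; nra.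
exists (e / (4 * B)) => [|y yp]; first by rewrite divr_gt0 // mulr_gt0.
pose c := B * nm (y - F p).
have c0 : 0 <= c by rewrite mulr_ge0 ?nm_ge0 // ltW.
have ce : 4 * c < e.
  by move: yp; rewrite ltr_pdivlMr ?mulr_gt0 // /c; lra.
pose x := fix x k := if k is k'.+1 then x k' + (y - F (x k')) *m invmx J else p.
have xS k : x k.+1 - x k = (y - F (x k)) *m invmx J by rewrite /= addrAC subrr add0r.
have yF k : y - F (x k) = (x k.+1 - x k) *m J by rewrite xS mulmxKV.
have p0 k : 0 <= 2^-1 ^+ k :> R by rewrite exprn_ge0 // invr_ge0.
have key k : nm (x k - p) <= 2 * c * (1 - 2^-1 ^+ k) /\
    nm (x k.+1 - x k) <= c * 2^-1 ^+ k.
  elim: k => [|k [IH1 IH2]].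
    by rewrite subrr nm0 expr0 subrr mulr0 mulr1 xS; split=> //; exact: hB.
  have h1 : nm (x k.+1 - p) <= 2 * c * (1 - 2^-1 ^+ k.+1).
    have := nm_tri (x k) (x k.+1) p; rewrite exprS; lra.
  split=> //; rewrite xS (le_trans (hB _)) //.
  have -> : y - F (x k.+1) = - (F (x k.+1) - F (x k) - (x k.+1 - x k) *m J).
    by rewrite -yF !opprB addrA subrK.
  rewrite nmN.
  have i1 : nm (x k.+1 - p) < e by have := p0 k.+1; nra.
  have i2 : nm (x k - p) < e by have := p0 k; nra.
  have := hr e _ _ er i1 i2; set m := nm (x k.+1 - x k) in IH2 *.
  have m0 : 0 <= m := nm_ge0 _; set q := nm _ => hq; rewrite exprS.
  have : B * q <= B * (A * e * m) by rewrite ler_wpM2l // ltW.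
  have : B * (A * e) * m <= 2^-1 * m by rewrite ler_wpM2r.
  by lra.
have [l hl] := geom_cvg (fun k => (key k).2).
have lp : nm (l - p) < e by have := hl 0%N; rewrite expr0 mulr1 /= nmC; lra.
exists l; split; first by lra.
apply/esym/eqP; rewrite -subr_eq0; apply/eqP/nm0_eq0/eqP; rewrite eq_le nm_ge0 andbT.
rewrite leNgt; apply/negP => yl.
have Ae : 0 <= A * e by rewrite mulr_ge0 // ltW.
have [k hk] := @half_pow_lt R (B' * c + (A * e + B') * (4 * c)) _ yl.
have i2 : nm (x k - p) < e by have := p0 k; have [i1 _] := key k; nra.
have h1 : nm (F (x k) - F l) <= (A * e + B') * (4 * c * 2^-1 ^+ k).
  have := nmD (F (x k) - F l - (x k - l) *m J) ((x k - l) *m J).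
  rewrite subrK => /le_trans; apply.
  have := hr e _ _ er i2 lp; have := hB' (x k - l); have := hl k.
  set m := nm (x k - l); set t := _ * 2^-1 ^+ k => hm.
  have : (A * e + B') * m <= (A * e + B') * t by rewrite ler_wpM2l // addr_ge0 // ltW.
  by lra.
have h2 : nm (y - F (x k)) <= B' * (c * 2^-1 ^+ k).
  rewrite yF (le_trans (hB' _)) // ler_wpM2l ?(ltW B'0) //.
  by case: (key k).
have := nm_tri (F (x k)) y (F l).
by move: hk h1 h2; rewrite mulrDl; lra.
Qed.

End holomorphic_maps.

(** * Sets with few real coordinates *)

Section small_sets.
Context {R : realType}.
Local Notation C := R[i].

(** The real coordinates co are bounded on A, and the point phi x depends on them in a
Lipschitz way: phi(A) is the Lipschitz image of a bounded subset of R^I. *)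
Definition coordinates_on (T : Type) (I : finType) (V : normedZmodType C) (A : set T)
    (phi : T -> V) (co : T -> I -> R) (K L : R) :=
  (forall x, A x -> forall i, `|co x i| <= K) /\
  (forall x y d, A x -> A y -> 0 <= d -> (forall i, `|co x i - co y i| <= d) ->
     nm (phi x - phi y) <= L * d).

Definition coordinatized (I : finType) (V : normedZmodType C) (A : set V) :=
  exists co K L, coordinates_on (I := I) A id co K L.

Lemma coordinatized_image (T : Type) (I : finType) (V : normedZmodType C) (A : set T)
    (phi : T -> V) (co : T -> I -> R) (K L : R) :
  coordinates_on A phi co K L -> coordinatized I (phi @` A).
Proof.
move=> [bco lco].
pose co' v := if pselect (exists t, A t /\ phi t = v) is left e
  then co (projT1 (cid e)) else fun=> 0.
have co'P v : (phi @` A) v -> exists t, [/\ A t, phi t = v & co' v = co t].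
  move=> [t At tv]; rewrite /co'; case: pselect => [e|[]]; last by exists t.
  by case: cid => s /= [As sv]; exists s.
exists co', K, L; split=> [v /co'P[t [At _ ->]] i|v w d /co'P[t [At tv ->]] /co'P[s [As sw ->]]].
  exact: bco.
by rewrite -tv -sw; exact: lco.
Qed.

(** The points of the rays from a through A, up to dilation by S. *)
Definition cone (V : normedModType C) (a : V) (S : R) (A : set V) : set V :=
  (fun xs : V * R => a + xs.2%:C *: (xs.1 - a)) @` [set xs | A xs.1 /\ 0 <= xs.2 <= S].

(** The dilation factor is the additional coordinate. *)
Lemma coordinatized_cone (I : finType) (V : normedModType C) (a : V) (S : R) (A : set V) :
  coordinatized I A -> coordinatized (option I) (cone a S A).
Proof.
move=> [co [K [L [bco lco]]]].
have [[y Ay]|A0] := pselect (A !=set0); last first.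
  exists (fun _ _ => 0), 0, 0; by split=> [x|x y d] [[t s] [/= At _] _]; case: A0; exists t.
pose B := `|L| * (2 * `|K|) + nm (y - a).
have AB x : A x -> nm (x - a) <= B.
  move=> Ax; apply: le_trans (nm_tri y _ _) _; rewrite /B lerD2r.
  have K2 : 0 <= 2 * `|K| by rewrite mulr_ge0.
  apply: (@le_trans _ _ (L * (2 * `|K|))); last by rewrite ler_wpM2r // ler_norm.
  apply: lco => // i; have := bco x Ax i; have := bco y Ay i; have := ler_norm K.
  by have := ler_normB (co x i) (co y i); lra.
have B0 : 0 <= B := le_trans (nm_ge0 _) (AB y Ay).
apply: (@coordinatized_image _ _ _ _ _
  (fun xs o => if o is Some i then co xs.1 i else xs.2) (`|K| + `|S|) (`|S| * `|L| + B)).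
split=> [[x s] [/= Ax /andP[s0 sS]] [i|]|[x s] [x' s'] d [/= Ax /andP[s0 sS]]].
- by have := bco x Ax i; have := ler_norm K; have := normr_ge0 S; lra.
- by rewrite ger0_norm //; have := ler_norm S; have := normr_ge0 K; lra.
move=> [/= Ax' _] d0 hd.
have h1 : nm (x - x') <= `|L| * d.
  apply: le_trans (lco x x' d Ax Ax' d0 (fun i => hd (Some i))) _.
  by rewrite ler_wpM2r // ler_norm.
have h2 := hd None; rewrite /= in h2.
have -> : a + s%:C *: (x - a) - (a + s'%:C *: (x' - a)) =
    s%:C *: (x - x') + (s - s')%:C *: (x' - a).
  have -> : x - x' = (x - a) - (x' - a) by rewrite opprB addrA subrK.
  move: (x - a) (x' - a) => u v.
  by rewrite opprD addrACA subrr add0r rmorphB scalerBl scalerBr addrA subrK.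
rewrite (le_trans (nmD _ _)) // !nmZ !nmR (ger0_norm s0).
have h3 := AB x' Ax'.
have : s * nm (x - x') <= `|S| * (`|L| * d).
  by apply: ler_pM; rewrite ?nm_ge0 // (le_trans sS) // ler_norm.
have : `|s - s'| * nm (x' - a) <= d * B by apply: ler_pM; rewrite ?nm_ge0.
by lra.
Qed.

Definition nowhere_dense (V : normedZmodType C) (A : set V) :=
  forall x (r : R), 0 < r -> exists y (s : R), [/\ 0 < s, nm (y - x) + s <= r &
    forall z, nm (z - y) < s -> ~ A z].

(** Suppose that A meets every small ball inside the ball of centre x and radius r, and
choose a point of A close to each of the m^(2n) points of a fine grid there.  These
points of A are separated by a multiple of 1/m, so their coordinates lie in different cells of
a partition of the coordinate space into (Q m)^#|I| cells, with Q independent of m.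
As #|I| < 2n, this fails for m large. *)
Lemma coordinatized_nowhere_dense (I : finType) n (A : set 'rV[C]_n) :
  (#|I| < 2 * n)%N -> coordinatized I A -> nowhere_dense A.
Proof.
move=> In [co [K [L [bco lco]]]] x r r0; apply: contrapT => nA.
pose L1 := `|L| + 1; have L10 : 0 < L1 by rewrite /L1; have := normr_ge0 L; lra.
pose D := #|I|.
(* Q m cells of width eta cover [-K, K], and m > Q^#|I| makes m^(2n) > (Q m)^#|I|. *)
pose Q := (Num.truncn (32 * `|K| * L1 / r)).+1.
have Q1 : 32 * `|K| * L1 / r < Q%:R by exact: truncnS_gt.
pose m := (Q ^ D).+1.
have m0 : 0 < m%:R :> R by rewrite ltr0n.
(* The mesh of the grid. *)
pose h := r / (4 * m%:R); have h0 : 0 < h by rewrite divr_gt0 // mulr_gt0.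
have mh : m%:R * h = r / 4 by rewrite /h; field; rewrite gt_eqF.
pose pt (f : {ffun 'I_n * bool -> 'I_m}) : 'rV[C]_n :=
  x + \row_j ((h * (f (j, false))%:R) +i* (h * (f (j, true))%:R)).
have near f : exists a, A a /\ nm (a - pt f) < h / 4.
  apply: contrapT => /forallNP H; apply: nA; exists (pt f), (h / 4); split.
  - by lra.
  - have : nm (pt f - x) <= r / 2.
      rewrite /pt addrAC subrr add0r; apply: nm_rV_le => [|j]; first by lra.
      rewrite mxE (le_trans (nm_ReIm _)) //=.
      have B b : `|h * (f (j, b))%:R| <= r / 4.
        have hf : 0 <= h * (f (j, b))%:R by rewrite mulr_ge0 // ltW.
        rewrite (ger0_norm hf) -mh mulrC; apply: ler_wpM2r; first exact: ltW.
        by rewrite ler_nat ltnW.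
      by have := B false; have := B true; lra.
    have : h <= r / 4 by rewrite -mh ler_peMl ?(ltW h0) // ler1n.
    by lra.
  - by move=> z zp Az; apply: (H z).
have [a ha] := choice near.
(* Points of A with coordinates in the same cell are at distance at most h/4. *)
pose eta := h / (4 * L1); have eta0 : 0 < eta by rewrite divr_gt0 // mulr_gt0.
have cell_ub f i : 0 <= (co (a f) i + `|K|) / eta < (Q * m)%:R.
  have := bco _ (ha f).1 i; rewrite ler_norml => /andP[b1 b2].
  have kk := ler_norm K.
  rewrite divr_ge0 ?(ltW eta0) //=; last by lra.
  rewrite ltr_pdivrMr //.
  have : 32 * `|K| * L1 / r * m%:R * eta < (Q * m)%:R * eta.
    by rewrite natrM !ltr_pM2r.
  have -> : 32 * `|K| * L1 / r * m%:R * eta = 2 * `|K|.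
    rewrite /eta /h; field; rewrite !gt_eqF //.
  by lra.
have cell_lt f i : (Num.truncn ((co (a f) i + `|K|) / eta) < Q * m)%N.
  by case/andP: (cell_ub f i) => c0 c1; rewrite truncn_lt_nat.
pose cell (f : {ffun 'I_n * bool -> 'I_m}) : {ffun I -> 'I_(Q * m)} :=
  [ffun i => Ordinal (cell_lt f i)].
have inj : injective cell.
  move=> f f' ff'; apply/ffunP => -[j b]; apply/eqP/negPn/negP => fj.
  have ap : nm (a f - a f') <= h / 4.
    apply: le_trans (lco _ _ eta (ha f).1 (ha f').1 (ltW eta0) _) _ => [i|]; last first.
      have : L * eta <= L1 * eta by rewrite ler_wpM2r ?(ltW eta0) // /L1; have := ler_norm L; lra.
      move=> /le_trans; apply; rewrite /eta.
      have -> : L1 * (h / (4 * L1)) = h / 4 by field; rewrite gt_eqF.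
      exact: lexx.
    have := congr1 (fun u : {ffun I -> 'I_(Q * m)} => val (u i)) ff'; rewrite !ffunE /=.
    case/andP: (cell_ub f i) => /truncn_itv/andP[u1 u2] _.
    case/andP: (cell_ub f' i) => /truncn_itv/andP[v1 v2] _.
    move=> E; rewrite E in u1 u2.
    rewrite !ler_pdivlMr // in u1 v1; rewrite !ltr_pdivrMr // -natr1 mulrDl mul1r in u2 v2.
    move: u1 u2 v1 v2; set t := _ * eta => *.
    by rewrite ler_distl; apply/andP; split; lra.
  have sep : h <= nm (pt f - pt f').
    apply: le_trans (nm_rV _ j); rewrite !mxE opprD addrACA subrr add0r.
    have step (u v : 'I_m) : u != v -> h <= `|h * u%:R - h * v%:R|.
      move=> uv; rewrite -mulrBr normrM (gtr0_norm h0) ler_peMr ?(ltW h0) //.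
      by move: uv; rewrite -val_eqE neq_ltn => /orP[] uv'; [rewrite distrC|];
        rewrite ler_normr -natrB ?(ltnW uv') // ler1n subn_gt0 uv'.
    case: b fj => /step /le_trans; apply; first exact: le_trans (nm_Im _).
    exact: le_trans (nm_Re _).
  have := nm_tri (a f) (pt f) (pt f'); have := nm_tri (a f') (a f) (pt f').
  by have := (ha f).2; have := (ha f').2; rewrite [nm (pt f - a f)]nmC; lra.
have := leq_card _ inj; rewrite !card_ffun !card_ord card_prod card_ord card_bool.
apply/negP; rewrite -ltnNge [(n * 2)%N]mulnC.
apply: (@leq_trans (m ^ D.+1)); last by rewrite leq_pexp2l.
by rewrite expnS expnMn ltn_pmul2r ?expn_gt0.
Qed.

(** Nested balls with radii at least halved at each step; the k-th step avoids the k-th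
set on the ball of twice the new radius, which contains the limit. *)
Lemma baire n (A : nat -> set 'rV[C]_n) (x : 'rV[C]_n) (r : R) : 0 < r ->
  (forall k, nowhere_dense (A k)) ->
  exists y, nm (y - x) < r /\ forall k, ~ A k y.
Proof.
move=> r0 hA.
have /choice[nxt hnxt] : forall kb : nat * ('rV[C]_n * R), exists b : 'rV[C]_n * R,
    0 < kb.2.2 -> [/\ 0 < b.2, b.2 <= kb.2.2 / 2, nm (b.1 - kb.2.1) + 2 * b.2 <= kb.2.2 &
      forall z, nm (z - b.1) < 2 * b.2 -> ~ A kb.1 z].
  move=> [k [c s]] /=; have [s0|s0] := leP s 0.
    by exists (0, 0).
  have [d [t [t0 dt ht]]] := hA k c s s0.
  exists (d, Num.min (t / 2) (s / 2)) => _ /=.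
  have tt : Num.min (t / 2) (s / 2) <= t / 2 by rewrite ge_min lexx.
  split; first by rewrite lt_min !divr_gt0.
  - by rewrite ge_min lexx orbT.
  - lra.
  - by move=> z zd; apply: ht; lra.
pose b := fix b k := if k is k'.+1 then nxt (k', b k') else (x, r / 2).
have b0 k : 0 < (b k).2.
  elim: k => [|k IH] /=; first by lra.
  by have [] := hnxt (k, b k) IH.
have bS k := hnxt (k, b k) (b0 k); rewrite /= -/b in bS.
have brad k : (b k).2 <= r / 2 * 2^-1 ^+ k.
  elim: k => [|k IH]; first by rewrite expr0 mulr1 /=.
  by have [_ h _ _] := bS k; rewrite exprS /=; move: h IH; set t := _ ^+ k; lra.
have [l hl] : exists l, forall k, nm ((b k).1 - l) <= 4 * (r / 2) * 2^-1 ^+ k.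
  apply: geom_cvg => k; have [h1 _ h2 _] := bS k; apply: le_trans _ (brad k) => /=; lra.
have nest k d : nm ((b (k + d)%N).1 - (b k).1) + (b (k + d)%N).2 <= (b k).2.
  elim: d => [|d IH]; first by rewrite addn0 subrr nm0 add0r.
  rewrite addnS; have [h1 h2 h3 _] := bS (k + d)%N.
  by have := nm_tri (b (k + d)%N).1 (b (k + d).+1).1 (b k).1 => /=; lra.
have inb k : nm (l - (b k).1) <= (b k).2.
  apply/ler_addgt0Pr => e e0.
  have [d hd] := @half_pow_lt R (4 * (r / 2)) e e0.
  have hp : 2^-1 ^+ (k + d) <= 2^-1 ^+ d :> R.
    by rewrite ler_wiXn2l ?invr_ge0 ?leq_addl // invf_le1 // ler1n.
  have := nest k d; have := b0 (k + d)%N; have := hl (k + d)%N; rewrite nmC.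
  have := nm_tri (b (k + d)%N).1 l (b k).1.
  have : 4 * (r / 2) * 2^-1 ^+ (k + d) <= 4 * (r / 2) * 2^-1 ^+ d.
    by rewrite ler_wpM2l //; lra.
  by lra.
exists l; split; first by have := inb 0%N; rewrite /=; lra.
move=> k; have [h1 _ _] := bS k; apply.
by have := inb k.+1; rewrite /=; lra.
Qed.

End small_sets.

(** * Level sets of holomorphic functions *)

Section sigma_small.
Context {R : realType}.
Local Notation C := R[i].

Lemma coordinatized0 (I : finType) (V : normedZmodType C) : coordinatized I (@set0 V).
Proof. by exists (fun _ _ => 0), 0, 0; split. Qed.

Definition sigma_coordinatized (I : finType) (V : normedZmodType C) (A : set V) :=
  exists B : nat -> set V, (forall k, coordinatized I (B k)) /\ A `<=` \bigcup_k B k.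

Section closure.
Variables (I : finType) (V : normedZmodType C).
Implicit Type A : set V.

Lemma sigma_coordinatized1 A : coordinatized I A -> sigma_coordinatized I A.
Proof. by move=> hA; exists (fun=> A); split=> // x Ax; exists 0%N. Qed.

Lemma sigma_coordinatized_sub A B : A `<=` B -> sigma_coordinatized I B ->
  sigma_coordinatized I A.
Proof. by move=> AB [D [hD BD]]; exists D; split=> // x /AB/BD. Qed.

Lemma sigma_coordinatized_bigcup (T : countType) (A : T -> set V) :
  (forall t, sigma_coordinatized I (A t)) -> sigma_coordinatized I (\bigcup_t A t).
Proof.
move=> /choice[B hB].
exists (fun k => if unpickle k is Some tk then B tk.1 tk.2 else set0); split.
  move=> k; case: unpickle => [[t j]|]; last exact: coordinatized0.
  by have [h _] := hB t; exact: h.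
move=> x [t _ Atx]; have [_ /(_ x Atx)[j _ Bx]] := hB t.
by exists (pickle (t, j)) => //=; rewrite pickleK.
Qed.

(** Lindelof's argument: the members of a countable base on which the property holds
cover X. *)
Lemma sigma_coordinatized_local (M : topologicalType) (X : set M) (phi : M -> V) :
  @second_countable M ->
  (forall p, X p -> exists W, nbhs p W /\ sigma_coordinatized I (phi @` (X `&` W))) ->
  sigma_coordinatized I (phi @` X).
Proof.
move=> [B /countable_injP[e einj] [Bopen Bbase]] loc.
pose good k b := [/\ B b, e b = k & sigma_coordinatized I (phi @` (X `&` b))].
pose A k := [set v | exists b, good k b /\ (phi @` (X `&` b)) v].
have hA k : sigma_coordinatized I (A k).
  have [[b gb]|nb] := pselect (exists b, good k b); last first.
    apply: (sigma_coordinatized_sub _ (sigma_coordinatized1 (coordinatized0 I V))).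
    by move=> v [b [gb _]]; case: nb; exists b.
  case: (gb) => Bb eb; apply: sigma_coordinatized_sub => v [b' [[Bb' eb' _] hv]].
  by rewrite (einj b b') ?inE // eb.
apply: sigma_coordinatized_sub (sigma_coordinatized_bigcup hA).
move=> _ [p Xp <-]; have [W [Wp hW]] := loc p Xp.
have [b [Bb bp] bW] := Bbase p W Wp.
exists (e b) => //; exists b; split; last by exists p.
split=> //; apply: sigma_coordinatized_sub hW => _ [q [Xq bq] <-].
by exists q => //; split=> //; exact: bW.
Qed.

End closure.

Section level_sets.
Variable n : nat.
Local Notation V := 'rV[C]_n.

Definition other_coords (j : 'I_n) (z : V) (ib : 'I_n.-1 * bool) : R :=
  if ib.2 then complex.Im (z 0 (lift j ib.1)) else complex.Re (z 0 (lift j ib.1)).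

(** Strict differentiability at q bounds the j-th coordinate of the difference of two zeros of h
by the other coordinates, because the j-th partial derivative is nonzero.  So the
zero set is a Lipschitz graph near q. *)
Lemma level_set_graph (U : set V) (h : V -> C) (q : V) (j : 'I_n) : open U -> hol U h -> U q ->
  pd j h q != 0 -> exists r L, [/\ 0 < r, forall z, nm (z - q) < r -> U z &
    forall z z' d, nm (z - q) < r -> nm (z' - q) < r -> h z = 0 -> h z' = 0 -> 0 <= d ->
      (forall ib, `|other_coords j z ib - other_coords j z' ib| <= d) ->
      nm (z - z') <= L * d].
Proof.
move=> oU hh Uq dj0; have [r [A [r0 A0 rU hr]]] := hol_strict oU hh Uq.
set D := grad h q; pose a := nm (pd j h q).
have a0 : 0 < a := nm_gt0 dj0.
(* On the ball of radius e the error of the linear approximation at q is at most half of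
   |d_j h(q)| times the distance. *)
pose e := Num.min r (a / 2 / (A + 1)).
have e0 : 0 < e by rewrite lt_min r0 !divr_gt0 //; lra.
have er : e <= r by rewrite ge_min lexx.
have Ae : A * e <= a / 2.
  have : e <= a / 2 / (A + 1) by rewrite ge_min lexx orbT.
  by rewrite ler_pdivlMr; nra.
pose c := a / 2 + n%:R * nm D.
have c0 : 0 <= c by rewrite /c addr_ge0 ?mulr_ge0 ?nm_ge0 //; lra.
exists e, (2 + 2 * c / (a / 2)); split=> //.
  by move=> z ze; apply: rU; lra.
move=> z z' d ze z'e hz hz' d0 hd.
have := hr e z z' er ze z'e; rewrite hz hz' subrr sub0r nmN -/D => h1.
set w := z - z' in h1 *.
have wo i : nm (w 0 (lift j i)) <= 2 * d.
  rewrite (le_trans (nm_ReIm _)) //.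
  have -> : complex.Re (w 0 (lift j i)) = other_coords j z (i, false) - other_coords j z' (i, false).
    by rewrite /other_coords /w /= !mxE; case: (z _ _) (z' _ _) => [? ?] [? ?].
  have -> : complex.Im (w 0 (lift j i)) = other_coords j z (i, true) - other_coords j z' (i, true).
    by rewrite /other_coords /w /= !mxE; case: (z _ _) (z' _ _) => [? ?] [? ?].
  by have := hd (i, false); have := hd (i, true); lra.
have wo' i : i != j -> nm (w 0 i) <= 2 * d.
  by case: (unliftP j i) => [i' ->|->]; rewrite ?eqxx.
set x := nm (w 0 j); have x0 : 0 <= x := nm_ge0 _.
have wx : nm w <= x + 2 * d.
  apply: nm_rV_le => [|i]; first by lra.
  by have [->|/wo'] := eqVneq i j; rewrite -/x; lra.
pose w' : V := \row_i (if i == j then 0 else w 0 i).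
have w'd : nm w' <= 2 * d.
  apply: nm_rV_le => [|i]; first by lra.
  by rewrite mxE; have [_|/wo' //] := eqVneq i j; rewrite nm0; lra.
have dotw : dot w D = w 0 j * pd j h q + dot w' D.
  rewrite /dot (bigD1 j) //= [in RHS](bigD1 j) //= !mxE eqxx mul0r add0r; congr (_ + _).
  by apply: eq_bigr => i ij; rewrite !mxE (negbTE ij).
have h2 : x * a <= A * e * nm w + n%:R * nm D * (2 * d).
  have := nmB (dot w D) (dot w' D).
  rewrite {1}dotw addrK nmM -/x -/a => /le_trans; apply; apply: lerD => //.
  by rewrite (le_trans (nm_dot_self _ _)) // ler_wpM2l // mulr_ge0 ?nm_ge0.
have h3 : x * (a / 2) <= 2 * c * d.
  have : A * e * nm w <= a / 2 * (x + 2 * d).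
    by apply: ler_pM => //; rewrite ?nm_ge0 // mulr_ge0 // ltW.
  by rewrite /c; lra.
have : x <= 2 * c / (a / 2) * d by rewrite mulrAC ler_pdivlMr //; lra.
by lra.
Qed.

(** A holomorphic map is locally Lipschitz, so it preserves the n-1 complex coordinates
of the level set. *)
Lemma level_set_image (U : set V) (F : V -> V) (h : V -> C) (q : V) (j : 'I_n) :
  open U -> holmap U F -> hol U h -> U q -> pd j h q != 0 ->
  exists r : R, [/\ 0 < r, forall z, nm (z - q) < r -> U z &
    coordinatized ('I_n.-1 * bool)%type (F @` [set z | nm (z - q) < r /\ h z = 0])].
Proof.
move=> oU hF hh Uq dj0.
have [r [L [r0 rU hr]]] := level_set_graph oU hh Uq dj0.
have [s [A [s0 A0 sU hs]]] := holmap_strict oU hF Uq.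
have [B B0 hB] := mulmx_bounded (jac F q).
exists (Num.min r s); split.
- by rewrite lt_min r0.
- by move=> z; rewrite lt_min => /andP[/rU].
apply: (@coordinatized_image _ _ _ _ _ F (other_coords j) (nm q + r) ((A * s + B) * L)).
split=> [z [/=]|z z' d [/=]]; rewrite lt_min => /andP[zr zs] hz.
  move=> [i b]; have zq : nm z <= nm q + r by have := nmD (z - q) q; rewrite subrK; lra.
  apply: le_trans zq; apply: le_trans (nm_rV _ (lift j i)); rewrite /other_coords /=.
  by case: b; [exact: nm_Im|exact: nm_Re].
move=> [/=]; rewrite lt_min => /andP[z'r z's] hz' d0 hd.
have zz' := hr z z' d zr z'r hz hz' d0 hd.
have := hs s z z' (lexx _) zs z's.
have := nmD (F z - F z' - (z - z') *m jac F q) ((z - z') *m jac F q); rewrite subrK.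
move=> h1 h2; have h3 := hB (z - z').
rewrite -mulrA; apply: (@le_trans _ _ ((A * s + B) * nm (z - z'))); first by lra.
by rewrite ler_wpM2l // addr_ge0 ?mulr_ge0 // ltW.
Qed.

End level_sets.
End sigma_small.

(** * Holomorphic maps in charts *)

Section bridge.
Context {R : realType}.
Local Notation C := R[i].

(** From differentiability in the sense of filters to the epsilon-delta expansion of each
component. *)
Lemma differentiable_gdiff m n (g : 'rV[C]_m -> 'rV[C]_n) z i : differentiable g z ->
  gdiff (fun w => g w 0 i) z (\row_j ('d g z (delta_mx 0 j)) 0 i).
Proof.
move=> dg e e0; have /eqaddoP := diff_locally dg.
move=> /(_ e%:C); rewrite ltcR => /(_ e0) /nbhs_nmP[d d0 hd]; exists d => // h hh.
have := hd h; rewrite subr0 => /(_ hh).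
rewrite !normE -rmorphM lecR; apply: le_trans; apply: le_trans (nm_rV _ i).
have -> : dot h (\row_j ('d g z (delta_mx 0 j)) 0 i) = ('d g z h) 0 i.
  rewrite {2}[h]row_sum_delta linear_sum summxE; apply: eq_bigr => j _.
  by rewrite linearZ !mxE.
have -> : (g \o shift z - (cst (g z) + 'd g z)) h = g (h + z) - (g z + 'd g z h) by [].
by rewrite !mxE opprD addrA [h + z]addrC.
Qed.

Lemma differential_jac n (g : 'rV[C]_n -> 'rV[C]_n) z h : differentiable g z ->
  'd g z h = h *m jac g z.
Proof.
move=> dg; apply/rowP => i; rewrite mul_jac (gradE (differentiable_gdiff i dg)).
rewrite {1}[h]row_sum_delta linear_sum summxE; apply: eq_bigr => j _.
by rewrite linearZ !mxE.
Qed.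

Lemma holomorphic_on_holmap n (U : set 'rV[C]_n) (g : 'rV[C]_n -> 'rV[C]_n) :
  holomorphic_on U g -> holmap U g.
Proof. by move=> hg i z /hg dg; eexists; exact: differentiable_gdiff dg. Qed.

Lemma surjective_mulmx n (J : 'M[C]_n) :
  (forall y : 'rV[C]_n, exists x : 'rV[C]_n, x *m J = y) <-> \det J != 0.
Proof.
split=> [H|dJ y]; last first.
  by exists (y *m invmx J); rewrite mulmxKV // unitmxE unitfE.
have /choice[x hx] := fun i : 'I_n => H (delta_mx 0 i).
have : (\matrix_i x i) *m J = 1%:M.
  by apply/row_matrixP => i; rewrite row_mul rowK hx row1.
by move=> /mulmx1_unit[_]; rewrite unitmxE unitfE.
Qed.

Lemma iterpd_zero m (g : 'rV[C]_m -> C) (q : 'rV[C]_m) (r : R) s :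
  (forall z, nm (z - q) < r -> g z = 0) -> forall z, nm (z - q) < r -> iterpd s g z = 0.
Proof.
move=> g0; elim: s => [//|j s IH] z zr /=; rewrite /pd.
suff /gradE -> : gdiff (iterpd s g) z 0 by rewrite mxE.
have r0 : 0 < r - nm (z - q) by lra.
apply: (diffat_ext (r := r - nm (z - q)) _ _ _ _ (@gdiff_cst _ _ 0 z)) => //.
  by rewrite nm0.
move=> h hr; rewrite IH //; have := nm_tri z (z + h) q; rewrite nm_shift; lra.
Qed.

Section charts.
Variables (n : nat) (M : topologicalType).
Implicit Types c : chart R n M.

Lemma chart_image_open c (A : set M) : open A -> open (c @` (chart_dom c `&` A)).
Proof.
move=> oA; rewrite openE => _ [p [cp Ap] <-].
have nA : nbhs p (chart_dom c `&` A).
  by apply: filterI; [exact: near_chart_dom|exact: open_nbhs_nbhs].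
apply: filterS2 (near_chart_invK cp) (chart_inv_cvg cp nA) => z zK [/= cz Az].
by exists (chart_inv c z).
Qed.

Lemma chart_map_cvg c p : chart_dom c p -> c @ p --> c p.
Proof.
move=> cp; have := @chart_map_continuous _ _ _ c.
rewrite continuous_open_subspace; last exact: chart_dom_open.
by move=> /(_ p); apply; rewrite inE.
Qed.

Lemma chart_map_inj c p q : chart_dom c p -> chart_dom c q -> c p = c q -> p = q.
Proof. by move=> cp cq e; rewrite -(chart_mapK cp) e chart_mapK. Qed.

Lemma chart_nbhs c p (r : R) : chart_dom c p -> 0 < r ->
  nbhs p [set q | chart_dom c q /\ nm (c q - c p) < r].
Proof.
move=> cp r0; apply: filterI; first exact: near_chart_dom.
have : nbhs (c p) [set z | nm (z - c p) < r] by apply/nbhs_nmP; exists r.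
exact: (chart_map_cvg cp).
Qed.

Lemma chart_nbhs_inv c p (W : set M) : chart_dom c p -> nbhs p W ->
  exists2 r : R, 0 < r & forall z, nm (z - c p) < r ->
    [/\ c (chart_inv c z) = z, chart_dom c (chart_inv c z) & W (chart_inv c z)].
Proof.
move=> cp pW.
have nW : nbhs p (chart_dom c `&` W) by apply: filterI => //; exact: near_chart_dom.
have /nbhs_nmP[r r0 hr] : nbhs (c p) [set z | c (chart_inv c z) = z /\
    (chart_dom c `&` W) (chart_inv c z)].
  exact: filterS2 (near_chart_invK cp) (chart_inv_cvg cp nW).
by exists r => // z /hr[? []].
Qed.

End charts.

Section maps.
Variables (n : nat) (M N : complexManifold R n) (f : M -> N) (hf : holomorphic f).

Definition local_map (c : chart R n M) (d : chart R n N) := d \o f \o chart_inv c.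
Definition local_dom (c : chart R n M) (d : chart R n N) :=
  c @` (chart_dom c `&` f @^-1` chart_dom d).

Lemma dom_preimage_open (d : chart R n N) : open (f @^-1` chart_dom d).
Proof. by apply: open_comp => [x _|]; [exact: hf.1|exact: chart_dom_open]. Qed.

Lemma local_dom_open c d : open (local_dom c d).
Proof. exact/chart_image_open/dom_preimage_open. Qed.

Lemma local_holmap c d : atlas c -> atlas d -> holmap (local_dom c d) (local_map c d).
Proof. by move=> ac ad; apply: holomorphic_on_holmap; exact: hf.2. Qed.

Definition local_det c d (z : 'rV[C]_n) := \det (jac (local_map c d) z).

Lemma local_det_hol c d : atlas c -> atlas d -> hol (local_dom c d) (local_det c d).
Proof.
move=> ac ad; apply: hol_det => j i.
have -> : (fun z => jac (local_map c d) z j i) = pd j (fun w => local_map c d w 0 i).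
  by apply/funext => z; rewrite mxE.
by apply: hol_pd; [exact: local_dom_open|exact: local_holmap].
Qed.

Lemma regular_pointP c d p : atlas c -> atlas d -> chart_dom c p -> chart_dom d (f p) ->
  regular_point hf p <-> local_det c d (c p) != 0.
Proof.
move=> ac ad cp dp.
pose cc : chart_at p := exist _ c (conj ac cp).
pose dd : chart_at (f p) := exist _ d (conj ad dp).
have dF : differentiable (local_map c d) (c p) by exact: (holomorphic_differentiable hf cc dd).
rewrite -surjective_mulmx; split=> [reg y|surj].
  have [g _ gK] := tangent_coord_bij dd.
  have [v _ hv] := reg (g y) I.
  exists (tangent_coord v cc).
  rewrite -differential_jac //; apply: etrans (esym (differentialE hf v cc dd)) _.
  by rewrite hv; exact: gK.
move=> w _; have [x hx] := surj (tangent_coord w dd).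
have [g _ gK] := tangent_coord_bij cc.
exists (g x) => //; have [g' g'K _] := tangent_coord_bij dd.
apply: (can_inj g'K); apply: etrans (differentialE hf _ cc dd) _.
by apply: etrans hx; rewrite -differential_jac //; congr ('d _ _ _); exact: gK.
Qed.

(** The inverse image given by [holmap_open] is found inside the domain of the local
expression of f, so it comes from a point of M. *)
Lemma regular_interior p : regular_point hf p -> nbhs (f p) (range f).
Proof.
have [c [ac cp]] := atlas_cover p; have [d [ad dp]] := atlas_cover (f p).
move=> /(regular_pointP ac ad cp dp) reg.
have Up : local_dom c d (c p) by exists p.
have [e e0 he] := open_ball_nm (@local_dom_open c d) Up.
have [r r0 hr] := holmap_open (@local_dom_open c d) (local_holmap ac ad) Up reg e0.
apply: filterS (chart_nbhs dp r0) => y [dy yr].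
have [|x [xe xy]] := hr (d y); first by rewrite /local_map /= chart_mapK.
have [p' [cp' dp'] xp'] := he x xe.
exists p' => //; apply: (chart_map_inj dp' dy).
by rewrite -xy -xp' /local_map /= chart_mapK.
Qed.

Definition critical : set M := [set p | ~ regular_point hf p].

Lemma criticalP c d p : atlas c -> atlas d -> chart_dom c p -> chart_dom d (f p) ->
  critical p <-> local_det c d (c p) = 0.
Proof.
move=> ac ad cp dp; have H := regular_pointP ac ad cp dp; split=> [np|h0 /H].
  by apply/eqP/negPn/negP => /H.
by rewrite h0 eqxx.
Qed.

(** Criticality does not depend on the charts, so the interior of the critical set can be
read off in any pair of charts. *)
Lemma critical_interior c d p : atlas c -> atlas d -> chart_dom c p -> chart_dom d (f p) ->
  critical° p <-> exists2 r : R, 0 < r & forall z, nm (z - c p) < r -> local_det c d z = 0.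
Proof.
move=> ac ad cp dp.
have nW : nbhs p (chart_dom c `&` f @^-1` chart_dom d).
  apply: filterI; first exact: near_chart_dom.
  by apply: open_nbhs_nbhs; split => //; exact: dom_preimage_open.
split=> [ip|[r r0 hr]].
  have [r r0 hr] := chart_nbhs_inv cp (filterI ip nW).
  exists r => // z /hr[zK _ [cr [cz dz]]].
  by have := (criticalP ac ad cz dz).1 cr; rewrite zK.
apply: filterS (filterI nW (chart_nbhs cp r0)) => q [[cq dq] [_ qr]].
by apply/(criticalP ac ad cq dq); exact: hr.
Qed.

End maps.
End bridge.

(** * The image of the critical set *)

Section critical_set.
Context {R : realType}.
Local Notation C := R[i].
Variables (n : nat) (M N : complexManifold R n) (f : M -> N) (hf : holomorphic f).
Local Notation crit := (critical hf).

(** Otherwise the determinant vanishes near p, so the critical set has interior points.  This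
interior is closed: at a limit point all the derivatives of the determinant vanish
by continuity, and the identity principle applies.  So it is all of M, against the
existence of a regular point. *)
Lemma local_det_not_flat c d p : connected [set: M] -> (exists p, regular_point hf p) ->
  atlas c -> atlas d -> chart_dom c p -> chart_dom d (f p) ->
  exists s, iterpd s (local_det f c d) (c p) <> 0.
Proof.
move=> cM [p0 reg0] ac ad cp dp; apply: contrapT => /forallNP flat0.
have flat s : iterpd s (local_det f c d) (c p) = 0 by apply: contrapT; exact: flat0.
suff E : crit° = [set: M].
  by have := @interior_subset _ crit p0; rewrite E => /(_ I); apply.
apply: cM.
- exists p; have Up : local_dom f c d (c p) by exists p.
  have [r r0 hr] := hol_flat (@local_dom_open _ _ _ _ _ hf c d) (local_det_hol hf ac ad) Up flat.
  by apply/(critical_interior hf ac ad cp dp); exists r => // z /hr[].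
- by exists crit°; [exact: open_interior|rewrite setTI].
exists (closure crit°); first exact: closed_closure.
rewrite setTI; apply/seteqP; split=> [|q clq]; first exact: subset_closure.
have [c' [ac' cq]] := atlas_cover q; have [d' [ad' dq]] := atlas_cover (f q).
pose g := local_det f c' d'.
have Uq : local_dom f c' d' (c' q) by exists q.
have oU := @local_dom_open _ _ _ _ _ hf c' d'.
have hg : hol _ g := local_det_hol hf ac' ad'.
have flatq s : iterpd s g (c' q) = 0.
  apply: contrapT => /eqP gs.
  have [e e0 he] := hol_cont oU (hol_iterpd s oU hg) Uq (nm_gt0 gs).
  have nq : nbhs q ([set x | chart_dom c' x /\ nm (c' x - c' q) < e] `&`
      f @^-1` chart_dom d').
    apply: filterI; first exact: chart_nbhs.
    by apply: open_nbhs_nbhs; split=> //; exact: dom_preimage_open.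
  have [x [ix [[cx ex] dx]]] := clq _ nq.
  have [t t0 ht] := (critical_interior hf ac' ad' cx dx).1 ix.
  have := iterpd_zero s ht (z := c' x); rewrite subrr nm0 => /(_ t0) gx.
  by have := he _ ex; rewrite gx sub0r nmN ltxx.
have [r r0 hr] := hol_flat oU hg Uq flatq.
by apply/(critical_interior hf ac' ad' cq dq); exists r => // z /hr[].
Qed.

(** At a critical point the determinant vanishes but not all its derivatives do.  Hence
some iterated derivative, indexed by s, vanishes there while its j-th partial derivative does
not; the level set of that derivative has a small image, and the pairs (s, j) are
countably many. *)
Lemma critical_image_small d : connected [set: M] -> (exists p, regular_point hf p) ->
  atlas d ->
  sigma_coordinatized ('I_n.-1 * bool)%type
    ((d \o f) @` (crit `&` f @^-1` chart_dom d)).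
Proof.
move=> cM ex_reg ad; apply: sigma_coordinatized_local; first exact: manifold_second_countable.
move=> p [_ dp]; have [c [ac cp]] := atlas_cover p.
have oU := @local_dom_open _ _ _ _ _ hf c d.
have hg := local_det_hol hf ac ad.
pose g (s : seq 'I_n) := iterpd s (local_det f c d).
pose W := chart_dom c `&` f @^-1` chart_dom d.
pose X (sj : seq 'I_n * 'I_n) := [set q | [/\ W q, g sj.1 (c q) = 0 & pd sj.2 (g sj.1) (c q) != 0]].
have WU q : W q -> local_dom f c d (c q) by move=> Wq; exists q.
exists W; split.
  apply: filterI; first exact: near_chart_dom.
  by apply: open_nbhs_nbhs; split=> //; exact: dom_preimage_open.
apply: (@sigma_coordinatized_sub _ _ _ _ (\bigcup_sj (d \o f) @` X sj)).
  move=> _ [q [[crq _] [cq dq]] <-].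
  suff [sj Xq] : exists sj, X sj q by exists sj => //; exists q.
  have [s hs] := local_det_not_flat cM ex_reg ac ad cq dq.
  elim: s hs => [|j s IH] hs; first by case: hs; exact/(criticalP hf ac ad cq dq).
  have [/eqP gs|/eqP gs] := eqVneq (g s (c q)) 0; last by apply: IH.
  by exists (s, j); split=> //; [exact/eqP|exact/eqP].
apply: sigma_coordinatized_bigcup => -[s j].
apply: sigma_coordinatized_local; first exact: manifold_second_countable.
move=> q [Wq gq dq] /=.
have [r [r0 rU hr]] := level_set_image oU (local_holmap hf ac ad) (hol_iterpd s oU hg) (WU q Wq) dq.
exists [set x | chart_dom c x /\ nm (c x - c q) < r]; split.
  by apply: chart_nbhs => //; case: Wq.
apply: sigma_coordinatized_sub (sigma_coordinatized1 hr).
move=> _ [x [[[cx dx] gx _] [_ xr]] <-].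
by exists (c x) => //; rewrite /local_map /= chart_mapK.
Qed.

End critical_set.

(** A point b' fails only if it lies on a ray from a through A, that is in one of countably
many cones of dimension less than 2n; Baire's theorem provides one that does not. *)
Lemma small_set_avoided (R : realType) (n : nat) (I : finType) (A : set 'rV[R[i]]_n)
    (a b : 'rV[R[i]]_n) (r : R) : (#|I|.+1 < 2 * n)%N -> sigma_coordinatized I A -> 0 < r ->
  exists b', nm (b' - b) < r /\ forall t : R, 0 < t <= 1 -> ~ A (a + t%:C *: (b' - a)).
Proof.
move=> In [B [hB AB]] r0.
pose D k := if unpickle k is Some (j, m) then cone a (m : nat)%:R (B j) else set0.
have hD k : nowhere_dense (D k).
  apply: (@coordinatized_nowhere_dense _ (option I)); first by rewrite card_option.
  rewrite /D; case: unpickle => [[j m]|]; last exact: coordinatized0.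
  exact: coordinatized_cone.
have [b' [b'r hb']] := baire b r0 hD.
exists b'; split=> // t /andP[t0 t1] /AB[j _ Bt].
pose m := (Num.truncn t^-1).+1.
apply: (hb' (pickle (j, m))); rewrite /D pickleK.
exists (a + t%:C *: (b' - a), t^-1) => /=.
  by split=> //; rewrite invr_ge0 (ltW t0) /= ltW // truncnS_gt.
rewrite [a + _ - a]addrAC subrr add0r scalerA -rmorphM mulVf ?gt_eqF //.
by rewrite scale1r subrKC.
Qed.

Theorem corollary1p4 (R : realType) (n : nat) (M N : complexManifold R n)
    (hM : connected [set: M]) (hN : connected [set: N])
    (f : M -> N) (hf : holomorphic f)
    (hreg : exists p : M, regular_point hf p)
    (hclosed : closed (range f)) :
  set_surj [set: M] [set: N] f.
Proof.
suff fE : range f = [set: N] by move=> y _; have : range f y by rewrite fE.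
apply: contrapT => nsurj.
pose U := (range f)°.
have [y [clU nU]] : exists y, closure U y /\ ~ U y.
  apply: contrapT => /forallNP H; apply: nsurj; apply/seteqP; split=> // y _.
  suff UT : U = [set: N] by apply: interior_subset; rewrite -/U UT.
  apply: hN.
  - by have [p /regular_interior] := hreg; exists (f p).
  - by exists U; [exact: open_interior|rewrite setTI].
  - exists (closure U); first exact: closed_closure.
    rewrite setTI; apply/seteqP; split; first exact: subset_closure.
    by move=> z clz; apply: contrapT => nz; apply: (H z).
have [d [ad dy]] := atlas_cover y.
have [r r0 hr] := chart_nbhs_inv dy filterT.
have [a [Ua [da ar]]] := clU _ (chart_nbhs dy r0).
have [b [db br nb]] : exists b, [/\ chart_dom d b, nm (d b - d y) < r & ~ range f b].
  apply: contrapT => /forallNP H; apply: nU; apply: filterS (chart_nbhs dy r0) => b [db br].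
  by apply: contrapT => nb; apply: (H b).
(* In dimension 0 the points a and b would coincide. *)
have n0 : (0 < n)%N.
  rewrite lt0n; apply/eqP => n0; apply: nb; have -> : b = a; last exact: interior_subset.
  by apply: (chart_map_inj db da); apply/rowP => i; have := ltn_ord i; rewrite [X in (_ < X)%N]n0.
have [e e0 he] : exists2 e : R, 0 < e & forall z, nm (z - d b) < e ->
    nm (z - d y) < r /\ ~ range f (chart_inv d z).
  have nbW : nbhs b (~` range f).
    by apply: open_nbhs_nbhs; split=> //; exact: closed_openC.
  have [e e0 he] := chart_nbhs_inv db nbW.
  exists (Num.min e (r - nm (d b - d y))); first by rewrite lt_min e0 subr_gt0.
  move=> z; rewrite lt_min => /andP[/he[_ _ nz] zb]; split=> //.
  by have := nm_tri (d b) z (d y); lra.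
have small := critical_image_small hM hreg ad.
have [|b' [b'b avoid]] := small_set_avoided (d a) (d b) _ small e0.
  by rewrite card_prod card_ord card_bool mulnC -[in X in (_ < X)%N](prednK n0) mulnS.
have [b'r nb'] := he b' b'b.
pose path t := d a + t%:C *: (b' - d a).
have path_in t : 0 <= t <= 1 -> nm (path t - d y) < r.
  by move=> t01; apply: seg_ball => //; rewrite subrKC.
pose G t := chart_inv d (path t).
have G0 : G 0 = a by rewrite /G /path scale0r addr0 chart_mapK.
(* A point of f(M) on the segment, other than a, is not a critical value by the choice of b'. *)
have GU t : 0 <= t <= 1 -> range f (G t) -> nbhs (G t) (range f).
  move=> t01 [p _ pG]; have [reg|crp] := pselect (regular_point hf p).
    by rewrite -pG; exact: regular_interior reg.
  have [dGt ddGt _] := hr _ (path_in t t01).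
  have [t0|t0] := leP t 0.
    have -> : t = 0 by apply/eqP; rewrite eq_le t0; case/andP: t01.
    by rewrite G0.
  case: (avoid t); first by case/andP: t01 => _ ->; rewrite t0.
  exists p; first by split=> //=; rewrite pG.
  by rewrite /= pG.
have Gcont t W : 0 <= t <= 1 -> nbhs (G t) W -> exists2 l : R, 0 < l &
    forall u, `|u - t| < l -> W (G u).
  move=> t01 GW; have [dGt ddGt _] := hr _ (path_in t t01).
  have [l l0 hl] := chart_nbhs_inv ddGt GW.
  have B : 0 < nm (b' - d a) + 1 by have := nm_ge0 (b' - d a); lra.
  exists (l / (nm (b' - d a) + 1)) => [|u]; first by rewrite divr_gt0.
  rewrite ltr_pdivlMr // => ul; have [|_ _ //] := hl (path u).
  rewrite dGt /path opprD addrACA subrr add0r -scalerBl -rmorphB nmZ nmR.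
  by have := normr_ge0 (u - t); nra.
apply: nb'; have -> : chart_inv d b' = G 1 by rewrite /G /path scale1r subrKC.
apply: (unit_segment_const (Q := fun t => range f (G t))); last first.
  by rewrite G0; exact: interior_subset Ua.
move=> t t01; have [rt|nt] := pselect (range f (G t)).
  have [l l0 hl] := Gcont t _ t01 (GU t t01 rt).
  exists l; first exact: l0.
  by move=> u /hl ru; split=> _; [exact: rt|exact: ru].
have nbW : nbhs (G t) (~` range f).
  by apply: open_nbhs_nbhs; split; [exact: closed_openC|exact: nt].
have [l l0 hl] := Gcont t _ t01 nbW.
exists l; first exact: l0.
move=> u /hl nu; exact: (conj (fun ru => False_ind _ (nu ru)) (fun rt => False_ind _ (nt rt))).
Qed.
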